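(* For every rational $\epsilon>0$ there is an $\epsilon$-almost-cover algorithm for \textsc{Multiset Multicover} whose running time is $f(m)\cdot|I|^{O(1)}$ for some computable function $f$ (depending on $\epsilon$), where $m=|U|$ is the size of the universe and $|I|$ is the input encoding length.
   Context: For a multiset $A$ and element $x$, $A(x)$ denotes the multiplicity of $x$ in $A$. An instance of \textsc{Multiset Multicover} consists of a universe $U=\{x_1,\dots,x_m\}$, a family $\mathcal{S}=\{S_1,\dots,S_n\}$ of multisets over $U$, integer covering requirements $r_1,\dots,r_m$, and an integer budget $B$; a (exact) solution is a subfamily $\mathcal{S}'\subseteq\mathcal{S}$ with $|\mathcal{S}'|\le B$ and $\sum_{S\in\mathcal{S}'}S(x_i)\ge r_i$ for all $i$. An $\epsilon$-almost-cover algorithm is an algorithm that, given such an instance which admits an exact solution, outputs a subfamily $\mathcal{S}'\subseteq\mathcal{S}$ with $|\mathcal{S}'|\le B$ such that, writing $r_i'=\sum_{S\in\mathcal{S}'}S(x_i)$, we have $\sum_{i=1}^m\max(0,r_i-r_i')<\epsilon\sum_{i=1}^m r_i$.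
   Formalization: The requirements r_i and budget B are taken to be nonnegative integers, and the strict inequality is demanded only when the sum of the r_i is positive, since if all r_i = 0 (or the sum is negative) no subfamily can satisfy it. *)

(* Defs.v *)
From mathcomp Require Import all_boot all_order all_algebra.
From mathcomp Require Import finmap multiset.

Set Implicit Arguments.
Unset Strict Implicit.
Unset Printing Implicit Defensive.

Import Order.TTheory GRing.Theory Num.Theory.

(** * Multiset Multicover *)

(* The universe {x_1, ..., x_m} is 'I_m; the family is indexed by 'I_n, so a
   subfamily is a set of indices and repeated multisets are allowed. *)
Record instance := Instance {
  univ_size : nat;
  num_sets : nat;
  mset_of : 'I_num_sets -> {mset 'I_univ_size}%mset;
  requirement : 'I_univ_size -> nat;
  budget : nat
}.

Definition coverage (I : instance) (X : {set 'I_(num_sets I)})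
    (i : 'I_(univ_size I)) : nat :=
  \sum_(j in X) mset_of j i.

Definition solution (I : instance) (X : {set 'I_(num_sets I)}) : Prop :=
  #|X| <= budget I /\ forall i, requirement i <= coverage X i.

Definition total_requirement (I : instance) : nat :=
  \sum_(i < univ_size I) requirement i.

(* Truncated subtraction: each summand is max(0, r_i - r'_i). *)
Definition shortfall (I : instance) (X : {set 'I_(num_sets I)}) : nat :=
  \sum_(i < univ_size I) (requirement i - coverage X i).

(* If all requirements are 0 then no subfamily at all can satisfy the strict
   inequality (it reads 0 < 0), so only then is it not demanded. *)
Definition almost_cover (eps : rat) (I : instance)
    (X : {set 'I_(num_sets I)}) : Prop :=
  #|X| <= budget I /\
  (0 < total_requirement I ->
   ((shortfall X)%:R < eps * (total_requirement I)%:R)%R).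

(** * Random access machines with logarithmic cost *)

(* The RAM of Aho, Hopcroft and Ullman (The Design and Analysis of Computer
   Algorithms, 1.2-1.3) under the logarithmic cost criterion, over the natural
   numbers and with structured control flow instead of jumps: every access to a
   register or a memory cell, and every arithmetic operation, is charged the
   binary length of all addresses and values involved. It is polynomially
   equivalent to Turing machines. *)

(* The number of binary digits of v; bitlen 0 = 1. *)
Definition bitlen (v : nat) : nat := (trunc_log 2 v).+1.

Record state := State { reg : nat -> nat; cell : nat -> nat }.

Definition update (g : nat -> nat) (a v : nat) : nat -> nat :=
  fun b => if b == a then v else g b.

Inductive expr :=
| Const of nat
| Reg of nat
| Fetch of expr
| Add of expr & expr
| Sub of expr & expr
| Mul of expr & expr
| Div of expr & expr.

Fixpoint eval (s : state) (e : expr) : nat :=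
  match e with
  | Const c => c
  | Reg x => reg s x
  | Fetch a => cell s (eval s a)
  | Add e1 e2 => eval s e1 + eval s e2
  | Sub e1 e2 => eval s e1 - eval s e2
  | Mul e1 e2 => eval s e1 * eval s e2
  | Div e1 e2 => eval s e1 %/ eval s e2
  end.

Fixpoint cost (s : state) (e : expr) : nat :=
  match e with
  | Const c => bitlen c
  | Reg x => bitlen x + bitlen (reg s x)
  | Fetch a => cost s a + bitlen (eval s a) + bitlen (cell s (eval s a))
  | Add e1 e2 | Sub e1 e2 | Mul e1 e2 | Div e1 e2 =>
      cost s e1 + cost s e2 + bitlen (eval s e1) + bitlen (eval s e2)
  end.

Inductive cmd :=
| Skip
| Assign of nat & expr
| Store of expr & expr
| Seq of cmd & cmd
| If of expr & cmd & cmd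
| While of expr & cmd.

(* exec c s s' t: run from s, the program c halts in s' after time t. *)
Inductive exec : cmd -> state -> state -> nat -> Prop :=
| exec_skip s : exec Skip s s 1
| exec_assign s x e :
    exec (Assign x e) s (State (update (reg s) x (eval s e)) (cell s))
      (cost s e + bitlen x + bitlen (eval s e))
| exec_store s a e :
    exec (Store a e) s (State (reg s) (update (cell s) (eval s a) (eval s e)))
      (cost s a + cost s e + bitlen (eval s a) + bitlen (eval s e))
| exec_seq c1 c2 s s1 s2 t1 t2 :
    exec c1 s s1 t1 -> exec c2 s1 s2 t2 -> exec (Seq c1 c2) s s2 (t1 + t2)
| exec_if_true e c1 c2 s s' t :
    eval s e != 0 -> exec c1 s s' t -> exec (If e c1 c2) s s' (cost s e + t)
| exec_if_false e c1 c2 s s' t :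
    eval s e = 0 -> exec c2 s s' t -> exec (If e c1 c2) s s' (cost s e + t)
| exec_while_true e c s s1 s2 t1 t2 :
    eval s e != 0 -> exec c s s1 t1 -> exec (While e c) s1 s2 t2 ->
    exec (While e c) s s2 (cost s e + t1 + t2)
| exec_while_false e c s :
    eval s e = 0 -> exec (While e c) s s (cost s e).

(* The input numbers occupy the memory cells 0, 1, 2, ...; all other cells and
   all registers are 0. *)
Definition init (w : seq nat) : state :=
  State (fun _ => 0) (fun a => nth 0 w a).

Definition computable (f : nat -> nat) : Prop :=
  exists c : cmd, forall k : nat, exists (s : state) (t : nat),
    exec c (init [:: k]) s t /\ cell s 0 = f k.

(** * Algorithms for Multiset Multicover *)

(* m, n, B, r_1, ..., r_m, S_1(x_1), ..., S_1(x_m), ..., S_n(x_m). *)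
Definition encode (I : instance) : seq nat :=
  [:: univ_size I, num_sets I, budget I
    & [seq requirement i | i <- enum 'I_(univ_size I)]
      ++ [seq mset_of j i | j <- enum 'I_(num_sets I),
                           i <- enum 'I_(univ_size I)]].

(* |I|: the numbers in the encoding are written in binary. *)
Definition input_size (I : instance) : nat :=
  \sum_(v <- encode I) bitlen v.

(* S_j is output iff the memory cell j is nonzero on halting. *)
Definition output (I : instance) (s : state) : {set 'I_(num_sets I)} :=
  [set j : 'I_(num_sets I) | cell s j != 0].

Definition almost_cover_algorithm (eps : rat) (c : cmd) : Prop :=
  forall I : instance, (exists X : {set 'I_(num_sets I)}, solution X) ->
  exists (s : state) (t : nat),
    exec c (init (encode I)) s t /\ almost_cover eps (output I s).

Definition runs_in_time (c : cmd) (T : instance -> nat) : Prop :=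
  forall I : instance, exists (s : state) (t : nat),
    exec c (init (encode I)) s t /\ t <= T I.

(* Main.v *)
From mathcomp Require Import all_boot all_order all_algebra.
From mathcomp Require Import finmap multiset zify ring.
Require Import Defs.

(* Each multiplicity S_j(x_i) is rescaled to a fraction S_j(x_i) / r_i of the
   requirement, measured in units of 1 / N with N = n C and C > 2 / eps. The sets
   are the leaves of a balanced binary tree. Bottom-up, every node stores, for each
   coverage vector reachable with the sets below it, the least number of sets
   reaching it, where vectors are rounded down to a grid of ratio 1 + 1/D after
   every addition. A set takes part in only O(log n) roundings, so D = O(C log n)
   keeps the total relative loss below 1 / C. The grid then has K = O(log^2 n)
   points up to N, and there are only K^m vectors per node; since
   (log n)^p <= g(p) n for some g, K^O(m) is at most f(m) n. *)

Set Implicit Arguments.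
Unset Strict Implicit.
Unset Printing Implicit Defensive.

Local Open Scope nat_scope.

(** * Binary length *)

(** Adding the sets one at a time would round n times in a row and force D of order C n, hence at
    least n^m vectors, which is not f(m) times a polynomial. The tree replaces n by its height. The
    bound C > 2 / eps consists of two shares 1 / C. One pays for the grid: h + 1 roundings at 1 / D
    each, with D = C (h + 1). The other pays for the floors in the leaves: at most n sets lose less
    than one unit each, and n units are N / C. Both losses are relative to each single requirement,
    so they can be summed over the universe. Coverage is clipped at N in the analysis, since
    multiplicities may be exponential in the input length while the grid has only to reach N.
    Numbers of sets are never rounded, so the budget is respected exactly. Time is separated from
    correctness: a bound W on all values and a bound L on all loops determine it from the syntax of
    the program. *)

Lemma bitlen_gt v : v < 2 ^ bitlen v.
Proof. exact: trunc_log_ltn. Qed.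

Lemma bitlen_le v k : v < 2 ^ k.+1 -> bitlen v <= k.+1.
Proof.
move=> lt_v; rewrite /bitlen ltnS; case: (posnP v) => [->|v0].
  by rewrite trunc_log0.
have := leq_ltn_trans (trunc_logP (isT : 1 < 2) v0) lt_v.
by rewrite ltn_exp2l.
Qed.

Lemma bitlen_leW v k : 0 < k -> v < 2 ^ k -> bitlen v <= k.
Proof. by case: k => // k _; apply: bitlen_le. Qed.

Lemma leq_bitlen u v : u <= v -> bitlen u <= bitlen v.
Proof. by move=> le_uv; rewrite /bitlen ltnS leq_trunc_log. Qed.

Lemma bitlen_add u v : bitlen (u + v) <= bitlen u + bitlen v.
Proof.
apply: bitlen_leW => //; rewrite expnD.
(* Two numbers that are at least 2 have a product at least as large as their sum. *)
have u0 : 1 < 2 ^ bitlen u by rewrite /bitlen expnS; have := expn_gt0 2 (trunc_log 2 u); lia.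
have v0 : 1 < 2 ^ bitlen v by rewrite /bitlen expnS; have := expn_gt0 2 (trunc_log 2 v); lia.
have := bitlen_gt u; have := bitlen_gt v; nia.
Qed.

Lemma bitlen_mul u v : bitlen (u * v) <= bitlen u + bitlen v.
Proof.
apply: bitlen_leW => //; rewrite expnD.
have := bitlen_gt u; have := bitlen_gt v; nia.
Qed.

(** * Total-correctness rules with a syntax-directed time bound *)

Definition assigned (s : state) (x v : nat) : state :=
  State (update (reg s) x v) (cell s).

Definition stored (s : state) (a v : nat) : state :=
  State (reg s) (update (cell s) a v).

(** Truncated subtraction makes the guard nonzero exactly while x is below the value of e, which is
    evaluated anew before each iteration. *)
Definition For (x : nat) (e : expr) (c : cmd) : cmd :=
  Seq (Assign x (Const 0))
      (While (Sub e (Reg x)) (Seq c (Assign x (Add (Reg x) (Const 1))))).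

(* With every register and cell of at most w bits, the value of e has at most
   expr_width e * w bits, and evaluating e costs at most expr_cost e * w. *)
Fixpoint expr_width (e : expr) : nat :=
  match e with
  | Const c => bitlen c
  | Reg _ | Fetch _ => 1
  | Add e1 e2 | Sub e1 e2 | Mul e1 e2 | Div e1 e2 =>
      expr_width e1 + expr_width e2
  end.

Fixpoint expr_cost (e : expr) : nat :=
  match e with
  | Const c => bitlen c
  | Reg x => bitlen x + 1
  | Fetch a => expr_cost a + expr_width a + 1
  | Add e1 e2 | Sub e1 e2 | Mul e1 e2 | Div e1 e2 =>
      expr_cost e1 + expr_cost e2 + expr_width e1 + expr_width e2
  end.

(* Bounds the time when each while loop makes at most L iterations. *)
Fixpoint time_bound (w L : nat) (c : cmd) : nat :=
  match c with
  | Skip => w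
  | Assign x e => (expr_cost e + bitlen x + 1) * w
  | Store a e => (expr_cost a + expr_cost e + expr_width a + 1) * w
  | Seq c1 c2 => time_bound w L c1 + time_bound w L c2
  | If e c1 c2 => expr_cost e * w + (time_bound w L c1 + time_bound w L c2)
  | While e c => L.+1 * (expr_cost e * w + time_bound w L c)
  end.

Fixpoint cmd_cost (c : cmd) : nat :=
  match c with
  | Skip => 1
  | Assign x e => expr_cost e + bitlen x + 1
  | Store a e => expr_cost a + expr_cost e + expr_width a + 1
  | Seq c1 c2 => cmd_cost c1 + cmd_cost c2
  | If e c1 c2 => expr_cost e + (cmd_cost c1 + cmd_cost c2)
  | While e c => expr_cost e + cmd_cost c
  end.

(** Sequential parts add their depths instead of taking the maximum, so that one common power bounds
    both; this affects only the degree of the polynomial. *)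
Fixpoint loop_depth (c : cmd) : nat :=
  match c with
  | Seq c1 c2 | If _ c1 c2 => loop_depth c1 + loop_depth c2
  | While _ c => (loop_depth c).+1
  | _ => 0
  end.

Lemma time_bound_le w L c :
  time_bound w L c <= cmd_cost c * w * L.+1 ^ loop_depth c.
Proof.
elim: c => [|x e|a e|c1 IH1 c2 IH2|e c1 IH1 c2 IH2|e c IH] /=; rewrite ?expn0 ?muln1 ?mul1n //.
- rewrite expnD; set X := L.+1 ^ _ in IH1 *; set Y := L.+1 ^ _ in IH2 *.
  have X0 : 0 < X by rewrite expn_gt0.
  have Y0 : 0 < Y by rewrite expn_gt0.
  rewrite !mulnDl; apply: leq_add.
    by apply: leq_trans IH1 _; rewrite mulnA leq_pmulr.
  by apply: leq_trans IH2 _; rewrite mulnCA [X in _ <= X]mulnC leq_pmulr.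
- rewrite expnD; set X := L.+1 ^ _ in IH1 *; set Y := L.+1 ^ _ in IH2 *.
  have X0 : 0 < X by rewrite expn_gt0.
  have Y0 : 0 < Y by rewrite expn_gt0.
  rewrite !mulnDl; apply: leq_add; first by rewrite leq_pmulr // muln_gt0 X0.
  apply: leq_add.
    by apply: leq_trans IH1 _; rewrite mulnA leq_pmulr.
  by apply: leq_trans IH2 _; rewrite mulnCA [X in _ <= X]mulnC leq_pmulr.
- rewrite expnS mulnCA leq_mul2l /= !mulnDl leq_add // leq_pmulr //.
  by rewrite expn_gt0.
Qed.

Section Rules.

Variables (W L : nat).

Let w := bitlen W.

Definition bounded (s : state) : Prop :=
  (forall x, reg s x <= W) /\ (forall a, cell s a <= W).

Lemma bitlen_eval s e : bounded s -> bitlen (eval s e) <= expr_width e * w.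
Proof.
case=> bR bC.
have w0 : 0 < w by [].
elim: e => [c|x|a _|e1 IH1 e2 IH2|e1 IH1 e2 IH2|e1 IH1 e2 IH2|e1 IH1 e2 IH2] /=;
  rewrite ?mul1n ?mulnDl.
- exact: leq_pmulr.
- exact: leq_bitlen.
- exact: leq_bitlen.
- exact: leq_trans (bitlen_add _ _) (leq_add IH1 IH2).
- by apply: leq_trans (leq_bitlen (leq_subr _ _)) (leq_trans IH1 (leq_addr _ _)).
- exact: leq_trans (bitlen_mul _ _) (leq_add IH1 IH2).
- by apply: leq_trans (leq_bitlen (leq_div _ _)) (leq_trans IH1 (leq_addr _ _)).
Qed.

Lemma cost_le s e : bounded s -> cost s e <= expr_cost e * w.
Proof.
move=> bs; have [bR bC] := bs.
have w0 : 0 < w by [].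
have we := fun e => bitlen_eval e bs.
elim: e => [c|x|a IH|e1 IH1 e2 IH2|e1 IH1 e2 IH2|e1 IH1 e2 IH2|e1 IH1 e2 IH2] /=;
  rewrite ?mulnDl ?mul1n; try by rewrite !leq_add.
- exact: leq_pmulr.
- by rewrite leq_add ?leq_pmulr ?leq_bitlen.
- by rewrite !leq_add ?leq_bitlen.
Qed.

(** Since [time_bound] depends on the program only, a correctness proof pays for time merely by
    showing that stored values stay at most W and that loops make at most L iterations. *)
Definition ends (c : cmd) (s : state) (Q : state -> Prop) : Prop :=
  exists s' t, [/\ exec c s s' t, t <= time_bound w L c, bounded s' & Q s'].

Lemma ends_weaken c s (Q Q' : state -> Prop) :
  (forall s', bounded s' -> Q s' -> Q' s') -> ends c s Q -> ends c s Q'.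
Proof.
by move=> QQ' [s' [t [ex le_t bs' Qs']]]; exists s', t; split=> //; apply: QQ'.
Qed.

Lemma ends_skip s (Q : state -> Prop) : bounded s -> Q s -> ends Skip s Q.
Proof. by move=> bs Qs; exists s, 1; split=> //; constructor. Qed.

Lemma bounded_assigned s x v : bounded s -> v <= W -> bounded (assigned s x v).
Proof. by case=> bR bC le_v; split=> //= y; rewrite /update; case: eqP. Qed.

Lemma bounded_stored s a v : bounded s -> v <= W -> bounded (stored s a v).
Proof. by case=> bR bC le_v; split=> //= y; rewrite /update; case: eqP. Qed.

Lemma assign_time s x e :
  bounded s -> eval s e <= W ->
  cost s e + bitlen x + bitlen (eval s e) <= time_bound w L (Assign x e).
Proof.
move=> bs le_v; rewrite /= !mulnDl mul1n !leq_add ?cost_le ?leq_bitlen //.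
exact: leq_pmulr.
Qed.

Lemma ends_assign s x e (Q : state -> Prop) :
  bounded s -> eval s e <= W -> Q (assigned s x (eval s e)) ->
  ends (Assign x e) s Q.
Proof.
move=> bs le_v Qs; do 2!eexists; split; first exact: exec_assign.
- exact: assign_time.
- exact: bounded_assigned.
- exact: Qs.
Qed.

(** Only the stored value has to be at most W; the address is paid for through [expr_width a] and
    may exceed W. *)
Lemma ends_store s a e (Q : state -> Prop) :
  bounded s -> eval s e <= W -> Q (stored s (eval s a) (eval s e)) ->
  ends (Store a e) s Q.
Proof.
move=> bs le_v Qs; do 2!eexists; split; first exact: exec_store.
- by rewrite /= !mulnDl mul1n !leq_add ?cost_le ?bitlen_eval ?leq_bitlen.
- exact: bounded_stored.
- exact: Qs.
Qed.

Lemma ends_seq c1 c2 s (Q1 Q : state -> Prop) :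
  ends c1 s Q1 -> (forall s1, bounded s1 -> Q1 s1 -> ends c2 s1 Q) ->
  ends (Seq c1 c2) s Q.
Proof.
move=> [s1 [t1 [ex1 le1 b1 Q1s]]] /(_ s1 b1 Q1s) [s2 [t2 [ex2 le2 b2 Qs]]].
exists s2, (t1 + t2); split=> //; first exact: exec_seq ex1 ex2.
exact: leq_add.
Qed.

Lemma ends_seq_assign x e c s (Q : state -> Prop) :
  bounded s -> eval s e <= W ->
  (bounded (assigned s x (eval s e)) -> ends c (assigned s x (eval s e)) Q) ->
  ends (Seq (Assign x e) c) s Q.
Proof.
move=> bs le_v H; apply: (@ends_seq _ _ _ (eq (assigned s x (eval s e)))).
  exact: ends_assign.
by move=> s1 b1 <-; apply/H/bounded_assigned.
Qed.

Lemma ends_seq_assignE v x e c s (Q : state -> Prop) :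
  bounded s -> eval s e = v -> v <= W ->
  (bounded (assigned s x v) -> ends c (assigned s x v) Q) ->
  ends (Seq (Assign x e) c) s Q.
Proof. by move=> bs <-; apply: ends_seq_assign. Qed.

Lemma ends_assignE v s x e (Q : state -> Prop) :
  bounded s -> eval s e = v -> v <= W -> Q (assigned s x v) ->
  ends (Assign x e) s Q.
Proof. by move=> bs <-; apply: ends_assign. Qed.

Lemma ends_storeE u v s a e (Q : state -> Prop) :
  bounded s -> eval s a = u -> eval s e = v -> v <= W -> Q (stored s u v) ->
  ends (Store a e) s Q.
Proof. by move=> bs <- <-; apply: ends_store. Qed.

Lemma ends_seq_store a e c s (Q : state -> Prop) :
  bounded s -> eval s e <= W ->
  (bounded (stored s (eval s a) (eval s e)) ->
   ends c (stored s (eval s a) (eval s e)) Q) ->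
  ends (Seq (Store a e) c) s Q.
Proof.
move=> bs le_v H; apply: (@ends_seq _ _ _ (eq (stored s (eval s a) (eval s e)))).
  exact: ends_store.
by move=> s1 b1 <-; apply/H/bounded_stored.
Qed.

Lemma ends_seq_storeE u v a e c s (Q : state -> Prop) :
  bounded s -> eval s a = u -> eval s e = v -> v <= W ->
  (bounded (stored s u v) -> ends c (stored s u v) Q) ->
  ends (Seq (Store a e) c) s Q.
Proof. by move=> bs <- <-; apply: ends_seq_store. Qed.

Lemma ends_if e c1 c2 s (Q : state -> Prop) :
  bounded s ->
  (eval s e != 0 -> ends c1 s Q) -> (eval s e = 0 -> ends c2 s Q) ->
  ends (If e c1 c2) s Q.
Proof.
move=> bs H1 H2; have [e0|e0] := eqVneq (eval s e) 0.
- have [s' [t [ex le_t bs' Qs']]] := H2 e0.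
  exists s', (cost s e + t); split=> //; first exact: exec_if_false.
  by rewrite /= leq_add ?cost_le // (leq_trans le_t) ?leq_addl.
- have [s' [t [ex le_t bs' Qs']]] := H1 e0.
  exists s', (cost s e + t); split=> //; first exact: exec_if_true.
  by rewrite /= leq_add ?cost_le // (leq_trans le_t) ?leq_addr.
Qed.

(** [Inv k] describes the state at the loop test with the counter already equal to k, which is why
    the body must establish it for the state after the increment. *)
Lemma ends_for x e c s nb (Inv : nat -> state -> Prop) (Q : state -> Prop) :
  bounded s -> nb <= L -> nb <= W ->
  (forall k s, Inv k s -> eval s e = nb) ->
  Inv 0 (assigned s x 0) ->
  (forall k s, k < nb -> bounded s -> reg s x = k -> Inv k s ->
    ends c s (fun s' => reg s' x = k /\ Inv k.+1 (assigned s' x k.+1))) ->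
  (forall s', bounded s' -> reg s' x = nb -> Inv nb s' -> Q s') ->
  ends (For x e c) s Q.
Proof.
move=> bs le_nbL le_nbW evE I0 step fin.
apply: ends_seq_assign => //= bs0.
have x0 : reg (assigned s x 0) x = 0 by rewrite /= /update eqxx.
set b := Seq c _.
(* Induction on the number d of remaining iterations; the factor [d.+1] also pays for the last,
   failing test. *)
have loop d : forall k s, k + d = nb -> bounded s -> reg s x = k -> Inv k s ->
    exists s' t, [/\ exec (While (Sub e (Reg x)) b) s s' t,
      t <= d.+1 * (expr_cost (Sub e (Reg x)) * w + time_bound w L b),
      bounded s', reg s' x = nb & Inv nb s'].
  elim: d => [|d IHd] k {I0 x0 bs0 bs}s kd bs xk Ik.
    exists s, (cost s (Sub e (Reg x))); split=> //.
    - by apply: exec_while_false; rewrite /= (evE _ _ Ik) xk; lia.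
    - by rewrite mul1n; apply: leq_trans (cost_le _ bs) (leq_addr _ _).
    - by rewrite xk; lia.
    - by rewrite -kd addn0.
  have lt_k : k < nb by lia.
  have [s1 [t1 [ex1 le1 bs1 [x1 I1]]]] := step _ _ lt_k bs xk Ik.
  have exA := exec_assign s1 x (Add (Reg x) (Const 1)).
  have evA : eval s1 (Add (Reg x) (Const 1)) = k.+1 by rewrite /= x1 addn1.
  have bsA : bounded (assigned s1 x k.+1) by apply: bounded_assigned => //; lia.
  have xA : reg (assigned s1 x k.+1) x = k.+1 by rewrite /= /update eqxx.
  have kd1 : k.+1 + d = nb by lia.
  have [s2 [t2 [ex2 le2 bs2 xs2 I2]]] := IHd k.+1 _ kd1 bsA xA I1.
  rewrite evA in exA.
  do 2!eexists; split.
  - apply: (exec_while_true _ (exec_seq ex1 exA) ex2).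
    by rewrite /= (evE _ _ Ik) xk; lia.
  - rewrite mulSn; apply: leq_add => //; apply: leq_add; first exact: cost_le.
    by apply: leq_add => //; rewrite -evA; apply: assign_time; rewrite ?evA //; lia.
  - exact: bs2.
  - exact: xs2.
  - exact: I2.
have [s' [t [ex le_t bs' xs' Is']]] := loop nb 0 _ (add0n _) bs0 x0 I0.
exists s', t; split=> //; last exact: fin.
by apply: leq_trans le_t _; rewrite [time_bound _ _ (While _ _)]/= leq_mul2r ltnS le_nbL orbT.
Qed.

End Rules.

(** * Rounding to a geometric grid *)

(* The gap above a grid point v is v %/ D + 1, so rounding an integer down to
   the grid loses a factor of at most 1 + 1/D. *)
Fixpoint grid (D k : nat) : nat :=
  if k is k'.+1 then grid D k' + grid D k' %/ D + 1 else 0.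

Fixpoint round_idx (D K v : nat) : nat :=
  if K is K'.+1 then if grid D K' <= v then K' else round_idx D K' v else 0.

Section Grid.

Variable D : nat.

Lemma grid_lt k : grid D k < 2 ^ k.
Proof.
elim: k => [//|k IH] /=; rewrite expnS.
have := leq_div (grid D k) D; lia.
Qed.

Lemma grid_add k d : 0 < D ->
  grid D k + d * (grid D k %/ D + 1) <= grid D (k + d).
Proof.
move=> D0; elim: d => [|d IH]; first by rewrite addn0 mul0n addn0.
rewrite [k + _]addnS /= mulSn.
have le : grid D k %/ D <= grid D (k + d) %/ D by apply: leq_div2r; apply: leq_trans (leq_addr _ _) IH.
move: le IH; move: (grid D k %/ D) (grid D (k + d) %/ D) => q q1; lia.
Qed.

(** D steps from g add at least D (g %/ D + 1), which exceeds g, so g + 1 at least doubles. *)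
Lemma grid_double l : 0 < D -> 2 ^ l <= (grid D (D * l)).+1.
Proof.
move=> D0; elim: l => [|l IH]; first by rewrite muln0.
rewrite mulnS addnC expnS; apply: leq_trans (_ : 2 * (grid D (D * l)).+1 <= _).
  by rewrite leq_mul2l.
have := grid_add (D * l) D D0.
rewrite mulnDr muln1; have := divn_eq (grid D (D * l)) D.
have := ltn_pmod (grid D (D * l)) D0; nia.
Qed.

Lemma round_idx_lt K v : 0 < K -> round_idx D K v < K.
Proof.
elim: K => [//|K IH] _ /=; case: ifP => // _.
by case: K IH => [//|K] IH; apply: leq_trans (IH isT) _.
Qed.

Lemma grid_round_idx K v : grid D (round_idx D K v) <= v.
Proof. by elim: K => [//|K IH] /=; case: ifP. Qed.

Lemma round_idx_top K v : 0 < K -> grid D K.-1 <= v -> round_idx D K v = K.-1.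
Proof. by case: K => [//|K] _ /= ->. Qed.

Lemma round_idx0 K : round_idx D K 0 = 0.
Proof. by elim: K => [//|[//|K] IH]; rewrite /= addn1 in IH *. Qed.

Lemma round_idx_next K v : (round_idx D K v).+1 < K ->
  v < grid D (round_idx D K v).+1.
Proof.
elim: K => [//|K IH]; rewrite [round_idx _ _ _]/=; case: ifP => [_|/negbT nle lt].
  by rewrite ltnn.
case: (ltngtP (round_idx D K v).+1 K) => [/IH//|gt|eq]; first by lia.
by rewrite eq ltnNge.
Qed.

(** At the last index the grid value is at least N, so nothing of the clipped value is lost; at any
    other index the remainder above the grid point g is at most g %/ D. *)
Lemma round_idx_loss K N v : 0 < D -> 0 < K -> N <= grid D K.-1 ->
  D * minn N v <= D * grid D (round_idx D K v) + minn N v.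
Proof.
move=> D0 K0 top; set k := round_idx D K v.
have [lt|ge] := ltnP k.+1 K.
  have := round_idx_next lt; rewrite -/k /=.
  have gv : grid D k <= v by apply: grid_round_idx.
  have eqd := divn_eq (grid D k) D.
  move=> lt_v; have [le|lt_N] := leqP N (grid D k).
    have : minn N v <= grid D k by lia.
    nia.
  have : grid D k <= minn N v by lia.
  have : minn N v <= grid D k + grid D k %/ D by lia.
  nia.
have -> : k = K.-1 by have := @round_idx_lt K v K0; rewrite -/k; lia.
have : minn N v <= grid D K.-1 by lia.
nia.
Qed.

End Grid.

(** * Vectors of grid indices as numbers in base K *)

Definition digit (K a i : nat) : nat := (a %/ K ^ i) %% K.

Fixpoint build_key (K : nat) (d : nat -> nat) (m : nat) : nat :=
  if m is m'.+1 then build_key K d m' + d m' * K ^ m' else 0.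

Lemma build_key_lt K d m : 0 < K -> (forall i, i < m -> d i < K) ->
  build_key K d m < K ^ m.
Proof.
move=> K0; elim: m => [//|m IH] ltd /=.
have lt_m : d m < K by apply: ltd.
have : build_key K d m < K ^ m by apply: IH => i lt; apply: ltd; apply: ltnW.
rewrite expnS; nia.
Qed.

Lemma digit_build_key K d m i : 0 < K -> (forall i, i < m -> d i < K) ->
  i < m -> digit K (build_key K d m) i = d i.
Proof.
move=> K0; elim: m => [//|m IH] ltd lt_i.
have ltd' j : j < m -> d j < K by move=> lt; apply: ltd; apply: ltnW.
have Ki j : 0 < K ^ j by rewrite expn_gt0 K0.
rewrite /digit /=; move: lt_i; rewrite ltnS leq_eqVlt => /orP[/eqP ->|lt_i].
  by rewrite addnC divnMDl // divn_small ?build_key_lt // addn0 modn_small ?ltd.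
have -> : K ^ m = K ^ (m - i).-1 * K * K ^ i.
  by rewrite -expnSr prednK ?subn_gt0 // -expnD subnK // ltnW.
by rewrite !mulnA addnC divnMDl // modnMDl -/(digit _ _ _) IH.
Qed.

Lemma digit0 K i : digit K 0 i = 0.
Proof. by rewrite /digit div0n mod0n. Qed.

Lemma build_key_top K d m : 0 < K -> (forall i, i < m -> d i = K.-1) ->
  build_key K d m = (K ^ m).-1.
Proof.
move=> K0; elim: m => [//|m IH] eqd /=.
rewrite IH; last by move=> i lt; apply: eqd; apply: ltnW.
rewrite eqd // expnS; have := expn_gt0 K m; rewrite K0 /=; nia.
Qed.

(** * Sums along a heap-shaped binary tree *)

(** Heap numbering: the root is 1, node i has the children 2 i and 2 i + 1, and leaf n + j stands
    for set j. Every n gives a tree of logarithmic height, not only powers of two. *)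
Fixpoint heap_sum (n : nat) (x : nat -> nat) (fuel i : nat) : nat :=
  if fuel is f.+1 then
    if n <= i then x (i - n) else heap_sum n x f i.*2 + heap_sum n x f i.*2.+1
  else 0.

Lemma heap_sumS n x f i : heap_sum n x f.+1 i =
  if n <= i then x (i - n) else heap_sum n x f i.*2 + heap_sum n x f i.*2.+1.
Proof. by []. Qed.

(** A step down costs one unit of fuel and raises the positive index by at least one, so index plus
    fuel never decreases. *)
Lemma heap_sum_fuel n x f i : 0 < i -> 0 < f -> n < i + f ->
  heap_sum n x f i = heap_sum n x f.+1 i.
Proof.
elim: f i => [//|f IH] i i0 _ lt.
rewrite heap_sumS [RHS]heap_sumS; case: leqP => // lt_i.
by congr (_ + _); apply: IH; lia.
Qed.

Lemma heap_sum_leaf n x j : heap_sum n x n.+1 (n + j) = x j.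
Proof. by rewrite /= leq_addr addKn. Qed.

Lemma heap_sum_node n x i : 0 < i < n ->
  heap_sum n x n.+1 i = heap_sum n x n.+1 i.*2 + heap_sum n x n.+1 i.*2.+1.
Proof.
case/andP=> i0 lt; rewrite heap_sumS leqNgt lt.
by congr (_ + _); apply: heap_sum_fuel; lia.
Qed.

Lemma heap_root_le n (y : nat -> nat) : 0 < n ->
  (forall i, 0 < i < n -> y i <= y i.*2 + y i.*2.+1) ->
  y 1 <= \sum_(j < n) y (n + j).
Proof.
move=> n0 le_y.
(* The nodes k, ..., 2 k - 1 form a cut of the heap: replacing k by its children 2 k and 2 k + 1
   gives the next cut. The first cut is the root, the n-th is the set of leaves. *)
have H k : 0 < k <= n -> y 1 <= \sum_(k <= i < k.*2) y i.
  elim: k => [//|[|k] IH] bk; first by rewrite big_nat1.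
  apply: leq_trans (IH _) _; first by lia.
  rewrite big_ltn ?doubleS; last by lia.
  rewrite [X in _ <= X]big_nat_recr /=; last by lia.
  rewrite [X in _ <= X + _]big_nat_recr /=; last by lia.
  by have := le_y k.+1; rewrite doubleS; lia.
have := H n; rewrite n0 leqnn => /(_ isT).
by rewrite -{1}[n]add0n -addnn big_addn addnK big_mkord; under eq_bigr do rewrite addnC.
Qed.

Lemma heap_root_ge n (y : nat -> nat) : 0 < n ->
  (forall i, 0 < i < n -> y i.*2 + y i.*2.+1 <= y i) ->
  \sum_(j < n) y (n + j) <= y 1.
Proof.
move=> n0 le_y.
have H k : 0 < k <= n -> \sum_(k <= i < k.*2) y i <= y 1.
  elim: k => [//|[|k] IH] bk; first by rewrite big_nat1.
  apply: leq_trans (IH _); last by lia.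
  rewrite [X in _ <= X]big_ltn ?doubleS; last by lia.
  rewrite big_nat_recr /=; last by lia.
  rewrite big_nat_recr /=; last by lia.
  by have := le_y k.+1; rewrite doubleS; lia.
have := H n; rewrite n0 leqnn => /(_ isT).
by rewrite -{1}[n]add0n -addnn big_addn addnK big_mkord; under eq_bigr do rewrite addnC.
Qed.

(** * The dynamic program on the heap *)

Section DynamicProgram.

Variables (m n B C c h : nat) (r : nat -> nat) (S : nat -> nat -> nat).

Definition scale := n * C.
Definition grid_den := C * h.+1.
(** Every D steps double the grid, so index D (h + c) reaches 2 ^ (h + c) - 1, which is at least N =
    n 2 ^ c when n < 2 ^ h. *)
Definition grid_size := grid_den * (h + c) + 1.
Definition num_keys := grid_size ^ m.

Local Notation N := scale.
Local Notation D := grid_den.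
Local Notation K := grid_size.
Local Notation M := num_keys.

Definition key_of (v : nat -> nat) : nat :=
  build_key K (fun i => round_idx D K (v i)) m.

Definition key_val (a i : nat) : nat := grid D (digit K a i).

(** For r i = 0 the quotient is 0 by convention; such a coordinate passes the acceptance test
    through the factor r i there. *)
Definition leaf_val (j i : nat) : nat := S j i * N %/ r i.

Definition merge_val (q i : nat) : nat := key_val (q %/ M) i + key_val (q %% M) i.

(* Rounds to the top grid index exactly when C * (N - key_val a i) <= 2 * N or
   r i = 0, and to 0 otherwise. *)
Definition test_val (a i : nat) : nat :=
  (2 * N * r i + 1 - C * (N - key_val a i) * r i) * grid D (K - 1).

(* T i a is n.+1 minus the least number of sets below node i that reach the key
   a, or 0 if a is not reached; W i a codes a pair of keys of the children. *)
Definition merged (T W : nat -> nat -> nat) (i k : nat) : Prop :=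
  [/\ forall a, a < M -> T i a <= n.+1,
      forall a, a < M -> 0 < T i a ->
        [/\ W i a < M * M, a = key_of (merge_val (W i a))
          & T i a = T i.*2 (W i a %/ M) + T i.*2.+1 (W i a %% M) - n.+1]
    & forall q, q < k ->
        T i.*2 (q %/ M) + T i.*2.+1 (q %% M) - n.+1 <= T i (key_of (merge_val q))].

(** Key 0 with score n + 1 means that the set is not taken, score n that it is. The second condition
    is an inequality because the rounded vector of the set may itself be key 0. As score 0 means
    unreached, fresh memory is a correct empty table. *)
Definition leaf_ok (T : nat -> nat -> nat) (j : nat) : Prop :=
  [/\ T (n + j) 0 = n.+1, n <= T (n + j) (key_of (leaf_val j)),
      forall a, a < M -> T (n + j) a <= n.+1
    & forall a, a < M -> 0 < T (n + j) a ->
        a = 0 \/ a = key_of (leaf_val j) /\ T (n + j) a <= n].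

Definition passes (T : nat -> nat -> nat) (a : nat) : Prop :=
  [/\ 0 < T 1 a, n.+1 <= T 1 a + B & key_of (test_val a) = M.-1].

Hypotheses (n0 : 0 < n) (C_def : C = 2 ^ c) (c0 : 0 < c) (n_lt : n < 2 ^ h).

Lemma C_ge2 : 2 <= C.
Proof. by rewrite C_def -{1}(expn1 2) leq_exp2l. Qed.

Lemma D_gt0 : 0 < D.
Proof. by rewrite muln_gt0 /= andbT; have := C_ge2; lia. Qed.

Lemma K_gt0 : 0 < K.
Proof. by rewrite /grid_size addn1. Qed.

Lemma M_gt0 : 0 < M.
Proof. by rewrite expn_gt0 K_gt0. Qed.

Lemma scale_le_top : N <= grid D (K - 1).
Proof.
have := grid_double (h + c) D_gt0; rewrite expnD -C_def /grid_size addnK.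
have := C_ge2; rewrite /scale; nia.
Qed.

Lemma scale_le_top' : N <= grid D K.-1.
Proof. by have := scale_le_top; rewrite subn1. Qed.

Lemma round_lt v : round_idx D K v < K.
Proof. exact: round_idx_lt K_gt0. Qed.

Lemma key_of_lt v : key_of v < M.
Proof. by apply: build_key_lt; [exact: K_gt0 | move=> i _; apply: round_lt]. Qed.

Lemma digit_key_of v i : i < m -> digit K (key_of v) i = round_idx D K (v i).
Proof. by move=> lt; rewrite digit_build_key ?K_gt0 // => j _; apply: round_lt. Qed.

Lemma key_val_key_of v i : i < m ->
  key_val (key_of v) i <= v i /\
  D * minn N (v i) <= D * key_val (key_of v) i + minn N (v i).
Proof.
move=> lt; rewrite /key_val digit_key_of //; split; first exact: grid_round_idx.
by apply: round_idx_loss; [exact: D_gt0|exact: K_gt0|exact: scale_le_top'].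
Qed.

Lemma key_val0 i : key_val 0 i = 0.
Proof. by rewrite /key_val digit0. Qed.

(** Equality with the top key is a conjunction over all coordinates, so the acceptance test can
    reuse the subroutine that computes keys. *)
Lemma test_key a :
  key_of (test_val a) = M.-1 <->
  forall i, i < m -> C * (N - key_val a i) * r i <= 2 * N * r i.
Proof.
have top0 : 0 < grid D (K - 1).
  by apply: leq_trans scale_le_top; rewrite muln_gt0 n0; have := C_ge2; lia.
have K1 : 0 < K.-1.
  by move: top0; rewrite subn1; case: K.-1.
have K0 := K_gt0.
split=> [key i lt|le].
  have := digit_key_of (test_val a) lt.
  rewrite key -(@build_key_top K (fun=> K.-1)) // digit_build_key //; last by lia.
  move=> eqK; rewrite leqNgt; apply/negP => lt2.
  have z : test_val a i = 0.
    by rewrite /test_val; have -> : 2 * N * r i + 1 - C * (N - key_val a i) * r i = 0 by lia.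
  by rewrite z round_idx0 in eqK; lia.
rewrite /key_of; apply: build_key_top => // i /le le_i.
apply: round_idx_top => //; rewrite /test_val subn1.
apply: leq_pmull; lia.
Qed.

Variables (T W : nat -> nat -> nat).
Hypotheses (leavesP : forall j, j < n -> leaf_ok T j)
           (nodesP : forall i, 0 < i < n -> merged T W i (M * M)).

(* Every node at distance less than e from the leaves loses a factor 1 - e / D. *)
Lemma heap_complete (x : nat -> bool) e i : 0 < i < n.*2 -> n.*2 <= i * 2 ^ e ->
  exists2 a, a < M &
    n.+1 <= T i a + heap_sum n x n.+1 i /\
    forall k, k < m ->
      let v := minn N (heap_sum n (fun j => x j * leaf_val j k) n.+1 i) in
      D * v <= D * key_val a k + e * v.
Proof.
have M0 := M_gt0.
elim: e i => [|e IH] i /andP[i0 lt_i] le_e; first by rewrite muln1 in le_e; lia.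
have [le_ni|lt_in] := leqP n i.
  have -> : i = n + (i - n) by lia.
  have lt_j : i - n < n by lia.
  set j := i - n in lt_j *; have [T0 Tk _ _] := leavesP lt_j.
  rewrite heap_sum_leaf; case xj: (x j); last first.
    exists 0 => //; split=> [|k _]; first by rewrite T0 addn0.
    by cbv zeta; rewrite heap_sum_leaf xj mul0n minn0 !muln0.
  exists (key_of (leaf_val j)); first exact: key_of_lt.
  split=> [|k lt_k]; first by rewrite addn1.
  cbv zeta; rewrite heap_sum_leaf xj mul1n mulSn.
  have [_ le] := key_val_key_of (leaf_val j) lt_k.
  exact: leq_trans le (leq_add (leqnn _) (leq_addr _ _)).
have le2 : n.*2 <= i.*2 * 2 ^ e by rewrite expnS mulnA muln2 in le_e.
have le21 : n.*2 <= i.*2.+1 * 2 ^ e.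
  by apply: leq_trans le2 _; rewrite leq_mul2r leqnSn orbT.
have b2 : 0 < i.*2 < n.*2 by lia.
have b21 : 0 < i.*2.+1 < n.*2 by lia.
have [a1 lt1 [cnt1 val1]] := IH _ b2 le2.
have [a2 lt2 [cnt2 val2]] := IH _ b21 le21.
have lt_i' : 0 < i < n by rewrite i0.
have [_ _ compl] := nodesP lt_i'.
pose q := a1 * M + a2.
have q1 : q %/ M = a1 by rewrite divnMDl // divn_small // addn0.
have q2 : q %% M = a2 by rewrite modnMDl modn_small.
have lt_q : q < M * M by rewrite /q; nia.
exists (key_of (merge_val q)); first exact: key_of_lt.
have := compl q lt_q; rewrite q1 q2 heap_sum_node // => le_T.
split=> [|k lt_k]; first by lia.
have [ub lb] := key_val_key_of (merge_val q) lt_k.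
rewrite heap_sum_node //.
have := val1 k lt_k; have := val2 k lt_k; cbv zeta.
move: ub lb; rewrite /merge_val q1 q2.
move: (key_val (key_of _) k) (key_val a1 k) (key_val a2 k).
move: (heap_sum n _ _ _) (heap_sum n _ _ _) => v1 v2 g g1 g2 ub lb le2' le1'.
set v := minn N (v1 + v2).
(* If the clipped sum of the rounded values reaches v, only the last rounding counts, since (D - 1)
   u is monotone in u. Otherwise g1 + g2 is below N and below v, the last rounding costs less than
   one share v, and D v <= D (g1 + g2) + e v remains. *)
have [le_s|lt_s] := leqP v (minn N (g1 + g2)).
  have DE u : D * u = D.-1 * u + u by rewrite -mulSnr prednK ?D_gt0.
  have : D.-1 * v <= D.-1 * minn N (g1 + g2) by rewrite leq_mul2l le_s orbT.
  by move: lb; rewrite !DE mulSn; lia.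
have sE : minn N (g1 + g2) = g1 + g2 by lia.
rewrite sE in lb lt_s.
have [v1N|v1N] := leqP N v1.
  have vN : v = N by lia.
  have mN : minn N v1 = N by lia.
  by move: lb; rewrite mN in le1'; rewrite vN mulnDr mulSn in lt_s *; lia.
have [v2N|v2N] := leqP N v2.
  have vN : v = N by lia.
  have mN : minn N v2 = N by lia.
  by move: lb; rewrite mN in le2'; rewrite vN mulnDr mulSn in lt_s *; lia.
have m1 : minn N v1 = v1 by lia.
have m2 : minn N v2 = v2 by lia.
rewrite m1 in le1'; rewrite m2 in le2'.
have [le_N|lt_N] := leqP (v1 + v2) N.
  have vE : v = v1 + v2 by lia.
  by move: lb; rewrite vE mulSn !mulnDr in lt_s *; lia.
have vE : v = N by lia.
rewrite vE in lt_s *.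
(* The bound for v1 + v2 passes to the smaller value N after multiplication by D - e, which must be
   positive; for D <= e the claim is trivial. *)
have [le_De|lt_De] := leqP D e.
  by apply: leq_trans (leq_addl _ _); rewrite leq_mul2r (leqW le_De) orbT.
have De : D = e + (D - e) by lia.
have DN : D * N = e * N + (D - e) * N by rewrite -mulnDl -De.
have Dv : D * (v1 + v2) = e * (v1 + v2) + (D - e) * (v1 + v2).
  by rewrite -mulnDl -De.
have le_f : (D - e) * N <= (D - e) * (v1 + v2).
  by rewrite leq_mul2l (ltnW lt_N) orbT.
rewrite mulSn; move: lb le1' le2' DN Dv le_f lt_s; rewrite !mulnDr; lia.
Qed.

Lemma dp_complete (x : nat -> bool) :
  \sum_(j < n) x j <= B ->
  (forall i, i < m -> r i <= \sum_(j < n) x j * S j i) ->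
  exists2 a, a < M & passes T a.
Proof.
move=> cardX coverX.
have rootE (y : nat -> nat) : heap_sum n y n.+1 1 = \sum_(j < n) y j.
  transitivity (\sum_(j < n) heap_sum n y n.+1 (n + j)); last first.
    by apply: eq_bigr => j _; rewrite heap_sum_leaf.
  apply/eqP; rewrite eqn_leq; apply/andP; split.
    by apply: heap_root_le => // i /heap_sum_node ->.
  by apply: (@heap_root_ge n (heap_sum n y n.+1)) => // i /heap_sum_node ->.
(* From the root, h + 1 doublings lead past the leaves because n < 2 ^ h; as D = C (h + 1), the
   total loss is 1 / C. *)
have [||a lt_a [cnt val]] := @heap_complete x h.+1 1; first by lia.
  by rewrite mul1n expnS mul2n leq_double ltnW.
have le_n : \sum_(j < n) x j <= n.
  by rewrite -[X in _ <= X]card_ord -sum1_card leq_sum // => j _; case: (x j).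
rewrite rootE in cnt.
exists a => //; split; [lia|lia|apply/test_key => i lt_i].
have [->|r0] := posnP (r i); first by rewrite !muln0.
rewrite leq_mul2r; apply/orP; right.
have := val i lt_i; cbv zeta; rewrite rootE; set v := \sum_(j < n) _ => le_v.
(* Each chosen set loses less than one unit by the floor in [leaf_val]. *)
have le_rv : N <= v + n.
  rewrite -(leq_pmul2r r0); apply: leq_trans (_ : \sum_(j < n) x j * (S j i * N) <= _).
    apply: leq_trans (_ : (\sum_(j < n) x j * S j i) * N <= _).
      by rewrite mulnC leq_mul2r coverX ?orbT.
    by rewrite big_distrl /=; apply: leq_sum => j _; rewrite mulnA.
  rewrite mulnDl big_distrl /= -[X in _ <= _ + X * _]card_ord -sum1_card big_distrl /= -big_split /=.
  apply: leq_sum => j _; case: (x j) => /=; last by rewrite !mul0n.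
  rewrite !mul1n; rewrite {1}(divn_eq (S j i * N) (r i)) leq_add2l ltnW //.
  exact: ltn_pmod.
have vN : N <= minn N v + n by lia.
move: le_v vN; move: (minn N v) (key_val a i) => u g.
rewrite /grid_den /scale => le_v vN.
have {}le_v : C * u <= C * g + u.
  by rewrite -(@leq_pmul2r h.+1) //; move: le_v; move: h.+1 => e; nia.
have C1 : C.-1.+1 = C by have := C_ge2; lia.
(* With u the clipped sum: C (N - g) <= C (N - u) + u <= C n + N = 2 N. *)
rewrite -C1 in le_v vN *; rewrite mulnBr leq_subLR; nia.
Qed.

Variables (want : nat -> nat) (out : nat -> nat).
Hypotheses (want1 : want 1 < M) (pass1 : passes T (want 1))
  (wantP : forall i, 0 < i < n ->
    want i.*2 = W i (want i) %/ M /\ want i.*2.+1 = W i (want i) %% M)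
  (outP : forall j, j < n -> out j = n.+1 - T (n + j) (want (n + j))).

(** A positive score at a node forces positive scores at both children, since it is their sum minus
    n + 1 and each is at most n + 1. The induction goes from the parent [i./2] to i. *)
Lemma want_reached i : 0 < i < n.*2 ->
  [/\ want i < M, 0 < T i (want i) & T i (want i) <= n.+1].
Proof.
have M0 := M_gt0.
have ub k a : 0 < k < n.*2 -> a < M -> T k a <= n.+1.
  move=> /andP[k0 lt_k] lt_a; have [le|lt] := leqP n k.
    have -> : k = n + (k - n) by lia.
    by have [|_ _ + _] := @leavesP (k - n); [lia | apply].
  by have [|+ _ _] := @nodesP k; [lia | apply].
elim/ltn_ind: i => i IH bi.
suff [lt_w w0] : want i < M /\ 0 < T i (want i) by split=> //; apply: ub.
have [->|i1] := eqVneq i 1; first by have [] := pass1.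
have b2 : 0 < i./2 < n by lia.
have lt_half : i./2 < i by lia.
have b22 : 0 < i./2 < n.*2 by lia.
have [lt_w w0 _] := IH _ lt_half b22.
have [_ /(_ _ lt_w w0) [lt_W _ TE] _] := nodesP b2.
have [w2 w21] := wantP b2.
have lt1 : W i./2 (want i./2) %/ M < M by rewrite ltn_divLR.
have lt2 : W i./2 (want i./2) %% M < M by rewrite ltn_mod.
have bd : 0 < i./2.*2 < n.*2 by lia.
have bd1 : 0 < i./2.*2.+1 < n.*2 by lia.
have ub1 := ub _ _ bd lt1; have ub2 := ub _ _ bd1 lt2.
have [odd_i|even_i] := boolP (odd i).
  have -> : i = i./2.*2.+1 by rewrite -[LHS]odd_double_half odd_i.
  by rewrite w21; split=> //; lia.
have -> : i = i./2.*2 by rewrite -[LHS]odd_double_half (negbTE even_i).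
by rewrite w2; split=> //; lia.
Qed.

(** Two quantities are monotone along the heap: the number of sets n + 1 - T of a node is at least
    the sum over its children, and a key value, being rounded down, is at most the sum over its
    children. *)
Lemma dp_sound :
  \sum_(j < n) (out j != 0) <= B /\
  forall i, i < m ->
    C * (r i - \sum_(j < n) (out j != 0) * S j i) <= 2 * r i.
Proof.
have [_ cnt /test_key good] := pass1.
split.
  apply: leq_trans (_ : \sum_(j < n) out j <= _).
    by apply: leq_sum => j _; case: (out j).
  apply: leq_trans (_ : n.+1 - T 1 (want 1) <= _); last by lia.
  under eq_bigr => j _ do rewrite outP //.
  apply: (@heap_root_ge n (fun i => n.+1 - T i (want i))) => // i bi.
  have [|lt_w w0 _] := @want_reached i; first by lia.
  have [_ /(_ _ lt_w w0) [_ _ TE] _] := nodesP bi.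
  have [|_ _ u1] := @want_reached i.*2; first by lia.
  have [|_ _ u2] := @want_reached i.*2.+1; first by lia.
  by move: TE; have [<- <-] := wantP bi; lia.
move=> i lt_i.
have [->|r0] := posnP (r i); first by rewrite sub0n !muln0.
have N0 : 0 < N by rewrite muln_gt0 n0; have := C_ge2; lia.
have := good i lt_i; rewrite leq_mul2r => /orP[/eqP|]; first by lia.
have : key_val (want 1) i <= \sum_(j < n) key_val (want (n + j)) i.
  apply: (@heap_root_le n (fun k => key_val (want k) i)) => // k bk.
  have [|lt_w w0 _] := @want_reached k; first by lia.
  have [_ /(_ _ lt_w w0) [_ wE _] _] := nodesP bk.
  have [-> ->] := wantP bk.
  by rewrite {1}wE; have [] := key_val_key_of (merge_val (W k (want k))) lt_i.
set cov := \sum_(j < n) _ * _ => le_g.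
have {}le_g : key_val (want 1) i * r i <= cov * N.
  apply: leq_trans (_ : (\sum_(j < n) key_val (want (n + j)) i) * r i <= _).
    by rewrite leq_mul2r le_g orbT.
  rewrite !big_distrl; apply: leq_sum => j _ /=.
  have [|lt_w w0 _] := @want_reached (n + j); first by have := ltn_ord j; lia.
  have [_ _ _ /(_ _ lt_w w0)] := leavesP (ltn_ord j).
  case=> [->|[wE le_n]]; first by rewrite key_val0 mul0n.
  (* A leaf that uses its set has score at most n, so the set is output. *)
  have -> : out j != 0 by rewrite outP //; lia.
  rewrite mul1n wE.
  have [le_v _] := key_val_key_of (leaf_val j) lt_i.
  apply: leq_trans (_ : leaf_val j i * r i <= _); first by rewrite leq_mul2r le_v orbT.
  exact: leq_trunc_div.
move: le_g; move: (key_val _ _) (r i) r0 => g ri r0 le_g le_C.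
rewrite -(leq_pmul2r N0).
have [le|lt] := leqP ri cov.
  by have /eqP -> : ri - cov == 0; rewrite ?subn_eq0 // muln0.
have e : (N - g) * ri + g * ri >= N * ri.
  by rewrite -mulnDl leq_mul2r; apply/orP; right; lia.
have : C * (N - g) * ri <= 2 * N * ri by rewrite leq_mul2r le_C orbT.
have : (ri - cov) * N + cov * N = ri * N by rewrite -mulnDl subnK // ltnW.
nia.
Qed.

End DynamicProgram.

(** * The program *)

Local Notation rm := 0 (only parsing).
Local Notation rn := 1 (only parsing).
Local Notation rB := 2 (only parsing).
Local Notation rZ := 3 (only parsing).
Local Notation rN := 4 (only parsing).
Local Notation rD := 5 (only parsing).
Local Notation rK := 6 (only parsing).
Local Notation rM := 7 (only parsing).
Local Notation rh := 8 (only parsing).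
Local Notation rp := 9 (only parsing).
Local Notation rres := 10 (only parsing).
Local Notation ridx := 11 (only parsing).
Local Notation rv := 12 (only parsing).
Local Notation rc := 13 (only parsing).
Local Notation rk := 14 (only parsing).
Local Notation rq := 15 (only parsing).
Local Notation ri := 16 (only parsing).
Local Notation rt := 17 (only parsing).
Local Notation rg := 18 (only parsing).
Local Notation rs := 19 (only parsing).
Local Notation rpick := 20 (only parsing).
Local Infix ";;" := Seq (at level 60, right associativity).

Definition mod_expr (a b : expr) : expr := Sub a (Mul (Div a b) b).

(* Behind the Z input cells, the four tables (grid points, scores, split keys
   and wanted keys) occupy the addresses Z + 4 x + b, with b = 0, 1, 2, 3. *)
Definition slot (b x : expr) : expr :=
  Add (Add (Reg rZ) (Mul (Const 4) x)) b.

Definition table (b i a : expr) : expr := slot b (Add (Mul i (Reg rM)) a).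

(** The scan keeps the last grid point not above v, so one iteration is one unfolding of
    [round_idx]; v + 1 - g is nonzero exactly when g <= v. *)
Definition round_cmd : cmd :=
  Assign ridx (Const 0) ;;
  For rk (Reg rK)
    (If (Sub (Add (Reg rv) (Const 1)) (Fetch (slot (Const 0) (Reg rk))))
      (Assign ridx (Reg rk)) Skip).

(** A macro over the expression e, which finds the current coordinate in [rc]; it serves the leaves,
    the merges and the acceptance test. *)
Definition key_cmd (e : expr) : cmd :=
  Assign rres (Const 0) ;;
  Assign rp (Const 1) ;;
  For rc (Reg rm)
    (Assign rv e ;;
     round_cmd ;;
     Assign rres (Add (Reg rres) (Mul (Reg ridx) (Reg rp))) ;;
     Assign rp (Mul (Reg rp) (Reg rK))).

(* Inside key_cmd, rp holds K ^ i while the coordinate i is treated. *)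
Definition key_val_expr (a : expr) : expr :=
  Fetch (slot (Const 0) (mod_expr (Div a (Reg rp)) (Reg rK))).

(** * Correctness of the rounding and key subroutines *)

Definition agree (l : seq nat) (s s' : state) : Prop :=
  cell s' = cell s /\ forall x, x \notin l -> reg s' x = reg s x.

Lemma agree_assigned l s s' x v :
  x \in l -> agree l s s' -> agree l s (assigned s' x v).
Proof.
move=> lx [eq_c eq_r]; split=> // y ly; rewrite /= /update.
by case: eqP => [yx|_]; [rewrite yx lx in ly | apply: eq_r].
Qed.

Lemma agree_trans l1 l2 s1 s2 s3 :
  all (fun x => x \in l1) l2 -> agree l1 s1 s2 -> agree l2 s2 s3 -> agree l1 s1 s3.
Proof.
move=> /allP sub [c12 r12] [c23 r23]; split=> [|x nx]; first by rewrite c23.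
by rewrite r23 ?r12 //; apply: contra nx => /sub.
Qed.

Section Keys.

Variables (W L D K Z m : nat).
Hypotheses (K0 : 0 < K) (K_L : K <= L) (m_L : m <= L) (L_W : L <= W)
  (Km_W : K ^ m <= W).

Definition grid_stored (s : state) : Prop :=
  forall k, k < K -> cell s (Z + 4 * k) = grid D k.

Lemma round_ends s :
  bounded W s -> reg s rK = K -> reg s rZ = Z -> grid_stored s ->
  ends W L round_cmd s (fun s' =>
    agree [:: ridx; rk] s s' /\ reg s' ridx = round_idx D K (reg s rv)).
Proof.
move=> bs sK sZ sG.
apply: ends_seq_assign => // b0.
pose Inv k s' := agree [:: ridx; rk] s s' /\ reg s' ridx = round_idx D k (reg s rv).
apply: (@ends_for _ _ _ _ _ _ K Inv) => //; first exact: leq_trans L_W.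
- by move=> k s' [[_ ag] _]; rewrite /= ag.
- by split=> //; do 2!apply: agree_assigned => //.
- move=> k s' lt_k bs' xk [ag idx]; have [agc agr] := ag.
  have eG : eval s' (Fetch (slot (Const 0) (Reg rk))) = grid D k.
    by rewrite /= agc agr // sZ xk addn0 sG.
  have ev : reg s' rv = reg s rv by rewrite agr.
  apply: ends_if => //.
  + move=> ne; have {}ne : grid D k <= reg s rv.
      by move: ne; rewrite /= -/(eval s' (Fetch (slot (Const 0) (Reg rk)))) eG ev; lia.
    apply: ends_assign => //=; first by rewrite xk; lia.
    split; first by rewrite /update /=.
    split; first by do 2!apply: agree_assigned => //.
    by rewrite /update /= ne xk.
  + move=> e0; have {e0}lt : (grid D k <= reg s rv) = false.
      by move: e0; rewrite /= -/(eval s' (Fetch (slot (Const 0) (Reg rk)))) eG ev; lia.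
    apply: ends_skip => //; split=> //.
    split; first by apply: agree_assigned.
    by rewrite /update /= lt.
Qed.

Definition key_regs := [:: rres; rp; rc; rv; ridx; rk].

(** The loop changes the registers in [key_regs], so the caller must supply the value of e in every
    state that agrees with s elsewhere. *)
Lemma key_ends s e (vf : nat -> nat) :
  bounded W s -> reg s rm = m -> reg s rK = K -> reg s rZ = Z -> grid_stored s ->
  (forall s' i, i < m -> agree key_regs s s' -> reg s' rc = i ->
     reg s' rp = K ^ i -> eval s' e = vf i /\ vf i <= W) ->
  ends W L (key_cmd e) s (fun s' =>
    [/\ agree key_regs s s', reg s' rp = K ^ m &
        reg s' rres = build_key K (fun i => round_idx D K (vf i)) m]).
Proof.
move=> bs sm sK sZ sG ev.
have W0 : 0 < W by apply: leq_trans (leq_trans _ K_L) L_W.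
apply: ends_seq_assign => // b0; apply: ends_seq_assign => // b1.
pose Inv i s' := [/\ agree key_regs s s', reg s' rp = K ^ i &
  reg s' rres = build_key K (fun i => round_idx D K (vf i)) i].
apply: (@ends_for _ _ _ _ _ _ m Inv) => //; first exact: leq_trans L_W.
- by move=> k s' [[_ ag] _ _]; rewrite /= ag.
- by split=> //; do 3!apply: agree_assigned => //.
move=> i s1 lt_i bs1 xi [ag1 p1 res1].
have [ev1 vW] := ev _ _ lt_i ag1 xi p1.
apply: ends_seq_assign => //; first by rewrite ev1.
rewrite ev1 => b2; set s2 := assigned s1 _ _ in b2 *.
have ag2 : agree key_regs s s2 by apply: agree_assigned.
have [agc2 agr2] := ag2.
apply: ends_seq.
  by apply: round_ends => //; [rewrite agr2|rewrite agr2|rewrite /grid_stored agc2].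
move=> s3 b3 [ag3 idx3].
have ag3' : agree key_regs s s3 by apply: agree_trans ag2 ag3.
have r23 : reg s2 rv = vf i by [].
rewrite r23 in idx3.
have p3 : reg s3 rp = K ^ i by rewrite ag3.2.
have res3 : reg s3 rres = build_key K (fun i => round_idx D K (vf i)) i.
  by rewrite ag3.2.
have c3 : reg s3 rc = i by rewrite ag3.2.
have K3 : reg s3 rK = K by rewrite ag3'.2.
have Ki : K ^ i.+1 <= W.
  by apply: leq_trans Km_W; rewrite leq_pexp2l.
have ltk : build_key K (fun i => round_idx D K (vf i)) i.+1 < K ^ i.+1.
  by apply: build_key_lt => // j _; apply: round_idx_lt.
apply: ends_seq_assign => //.
  by rewrite /= p3 res3 idx3; apply: leq_trans Ki; apply: ltnW.
move=> b4; apply: ends_assign => //.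
  by rewrite /= /update /= p3 K3 mulnC -expnS.
rewrite /= /update /= p3 res3 idx3 K3; split=> //.
split; first by do 3!apply: agree_assigned => //.
  by rewrite /= /update /= mulnC -expnS.
by [].
Qed.

End Keys.

(** The final key computation, on the zero vector, is run for its side effect: it leaves K ^ m in
    [rp], which becomes M. *)
Definition setup_cmd (c : nat) : cmd :=
  Assign rn (Fetch (Const 1)) ;;
  Assign rB (Fetch (Const 2)) ;;
  Assign rZ (Add (Add (Const 3) (Reg rm)) (Mul (Reg rn) (Reg rm))) ;;
  Assign rN (Mul (Reg rn) (Const (2 ^ c))) ;;
  Assign rh (Const 0) ;;
  Assign rp (Const 1) ;;
  For rt (Reg rn)
    (If (Sub (Add (Reg rn) (Const 1)) (Reg rp))
      (Assign rp (Mul (Reg rp) (Const 2)) ;; Assign rh (Add (Reg rh) (Const 1)))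
      Skip) ;;
  Assign rD (Mul (Const (2 ^ c)) (Add (Reg rh) (Const 1))) ;;
  Assign rK (Add (Mul (Reg rD) (Add (Reg rh) (Const c))) (Const 1)) ;;
  Assign rg (Const 0) ;;
  For rt (Reg rK)
    (Store (slot (Const 0) (Reg rt)) (Reg rg) ;;
     Assign rg (Add (Add (Reg rg) (Div (Reg rg) (Reg rD))) (Const 1))) ;;
  key_cmd (Const 0) ;;
  Assign rM (Reg rp).

Definition leaf_expr : expr :=
  Div (Mul (Fetch (Add (Add (Add (Const 3) (Reg rm)) (Mul (Reg rt) (Reg rm)))
                       (Reg rc)))
           (Reg rN))
      (Fetch (Add (Const 3) (Reg rc))).

(** The order of the two stores matters: if the rounded vector of the set is key 0, not taking the
    set must win. *)
Definition leaves_cmd : cmd :=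
  For rt (Reg rn)
    (key_cmd leaf_expr ;;
     Store (table (Const 1) (Add (Reg rn) (Reg rt)) (Reg rres)) (Reg rn) ;;
     Store (table (Const 1) (Add (Reg rn) (Reg rt)) (Const 0))
       (Add (Reg rn) (Const 1))).

Definition merge_expr : expr :=
  Add (key_val_expr (Div (Reg rq) (Reg rM)))
      (key_val_expr (mod_expr (Reg rq) (Reg rM))).

Definition left_expr : expr := Mul (Const 2) (Reg ri).
Definition right_expr : expr := Add (Mul (Const 2) (Reg ri)) (Const 1).

(** The pair counter itself is the split that is remembered. A pair with an unreached child gets
    score 0 by truncated subtraction and never replaces an entry. *)
Definition merge_node_cmd : cmd :=
  For rq (Mul (Reg rM) (Reg rM))
    (key_cmd merge_expr ;;
     Assign rs
       (Sub (Add (Fetch (table (Const 1) left_expr (Div (Reg rq) (Reg rM))))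
                 (Fetch (table (Const 1) right_expr
                           (mod_expr (Reg rq) (Reg rM)))))
            (Add (Reg rn) (Const 1))) ;;
     If (Sub (Reg rs) (Fetch (table (Const 1) (Reg ri) (Reg rres))))
       (Store (table (Const 1) (Reg ri) (Reg rres)) (Reg rs) ;;
        Store (table (Const 2) (Reg ri) (Reg rres)) (Reg rq))
       Skip).

(** Decreasing order completes both children before their parent; [trace_cmd] runs in increasing
    order, as wanted keys flow from parent to children. *)
Definition merge_cmd : cmd :=
  For rt (Sub (Reg rn) (Const 1))
    (Assign ri (Sub (Sub (Reg rn) (Const 1)) (Reg rt)) ;;
     merge_node_cmd).

Definition test_expr (c : nat) : expr :=
  Mul (Sub (Add (Mul (Mul (Const 2) (Reg rN)) (Fetch (Add (Const 3) (Reg rc))))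
                (Const 1))
           (Mul (Mul (Const (2 ^ c)) (Sub (Reg rN) (key_val_expr (Reg rt))))
                (Fetch (Add (Const 3) (Reg rc)))))
      (Fetch (slot (Const 0) (Sub (Reg rK) (Const 1)))).

Definition pick_cmd (c : nat) : cmd :=
  Assign rpick (Const 0) ;;
  For rt (Reg rM)
    (key_cmd (test_expr c) ;;
     Assign rs (Fetch (table (Const 1) (Const 1) (Reg rt))) ;;
     If (Reg rs)
       (If (Sub (Reg rM) (Add (Reg rres) (Const 1))) Skip
         (If (Sub (Add (Reg rn) (Const 1)) (Add (Reg rs) (Reg rB))) Skip
           (Assign rpick (Reg rt))))
       Skip).

Definition trace_cmd : cmd :=
  Store (slot (Const 3) (Const 1)) (Reg rpick) ;;
  For rt (Sub (Reg rn) (Const 1))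
    (Assign ri (Add (Reg rt) (Const 1)) ;;
     Assign rs (Fetch (table (Const 2) (Reg ri)
                             (Fetch (slot (Const 3) (Reg ri))))) ;;
     Store (slot (Const 3) left_expr) (Div (Reg rs) (Reg rM)) ;;
     Store (slot (Const 3) right_expr) (mod_expr (Reg rs) (Reg rM))).

(** Writing over the input is safe: the tables begin at Z, which is at least n when m > 0. *)
Definition output_cmd : cmd :=
  For rt (Reg rn)
    (Store (Reg rt)
      (Sub (Add (Reg rn) (Const 1))
           (Fetch (table (Const 1) (Add (Reg rn) (Reg rt))
                     (Fetch (slot (Const 3) (Add (Reg rn) (Reg rt)))))))).

Definition main_cmd (c : nat) : cmd :=
  setup_cmd c ;; leaves_cmd ;; merge_cmd ;; pick_cmd c ;; trace_cmd ;; output_cmd.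

(* For m = 0 the encoding consists of m, n and B only, so that n can be
   exponential in its length, and nothing but the empty family is output. *)
Definition multicover_cmd (c : nat) : cmd :=
  Assign rm (Fetch (Const 0)) ;;
  If (Reg rm)
    (If (Fetch (Const 1)) (main_cmd c) Skip)
    (Store (Const 1) (Const 0) ;; Store (Const 2) (Const 0)).

Lemma bitlen_gtP n j : 0 < n -> (j < bitlen n) = (2 ^ j <= n).
Proof.
move=> n0; rewrite ltnS; apply/idP/idP; last exact: trunc_log_max.
move=> le; apply: leq_trans (trunc_logP (isT : 1 < 2) n0).
by rewrite leq_exp2l.
Qed.

(** * Correctness of the program on one input *)

Section Run.

Variables (W L m n B c : nat) (inp : nat -> nat).

Local Notation C := (2 ^ c).
Local Notation h := (bitlen n).
Local Notation N := (scale n C).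
Local Notation D := (grid_den C h).
Local Notation K := (grid_size C c h).
Local Notation M := (num_keys m C c h).
Local Notation Z := (3 + m + n * m).
Local Notation r := (fun i => inp (3 + i)).
Local Notation S := (fun j i => inp (3 + m + j * m + i)).

(** L covers the longest loop, over all M * M pairs of keys. [W_ge] is modelled on the acceptance
    test, which multiplies a number of at most 2 N r_i + 1 by a grid point below 2 ^ K. *)
Hypotheses (n0 : 0 < n) (m0 : 0 < m) (c0 : 0 < c)
  (inp1 : inp 1 = n) (inp2 : inp 2 = B) (inpZ : forall a, Z <= a -> inp a = 0)
  (L_ge : Z + K + M * M <= L) (L_W : L <= W)
  (W_ge : forall a, (2 * N * inp a + 1) * 2 ^ K <= W).

Let C2 : 2 <= C.
Proof. exact: (@C_ge2 C c). Qed.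

Let K0 : 0 < K.
Proof. exact: K_gt0. Qed.

Let M0 : 0 < M.
Proof. exact: M_gt0. Qed.

Let n_lt : n < 2 ^ h.
Proof. exact: bitlen_gt. Qed.

Let D0 : 0 < D.
Proof. exact: (D_gt0 n0 (erefl C) c0 n_lt). Qed.

Let M_le : M <= M * M.
Proof. by rewrite leq_pmulr. Qed.

Let N_ge : 2 * n <= N.
Proof. by rewrite /scale mulnC leq_mul2l C2 orbT. Qed.

Let n_le : n <= n * m.
Proof. by rewrite leq_pmulr. Qed.

Let W_n : 2 * n * n + 1 + 2 ^ K <= W.
Proof.
have := W_ge 1; rewrite inp1; apply: leq_trans.
have X0 : 0 < 2 ^ K by rewrite expn_gt0.
have : 2 * n * n + 1 <= 2 * N * n by nia.
move: (2 * N * n) (2 * n * n) (2 ^ K) X0 => u v X X0 le; nia.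
Qed.

Let W_N a : N * inp a <= W.
Proof.
apply: leq_trans (W_ge a); have : 0 < 2 ^ K by rewrite expn_gt0.
move: (2 ^ K) => X; move: (N * inp a) (mulnA 2 N (inp a)) => Y; nia.
Qed.

(** Parameters sit in registers 0 to 7 and scratch registers have larger numbers, so preservation is
    a comparison of register numbers. *)
Definition consts (s : state) : Prop :=
  forall x, x < 8 -> reg s x = nth 0 [:: m; n; B; Z; N; D; K; M] x.

Lemma consts_agree l s s' :
  all (leq 8) l -> agree l s s' -> consts s -> consts s'.
Proof.
move=> /allP ge8 [_ ag] cs x lt_x; rewrite ag ?cs //.
by apply/negP => /ge8; lia.
Qed.

Lemma consts_assigned s x v : 8 <= x -> consts s -> consts (assigned s x v).
Proof.
move=> ge8 cs y lt_y; rewrite /= /update; case: eqP => [|_]; last exact: cs.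
by lia.
Qed.

Definition base (s : state) : Prop :=
  (forall a, a < Z -> cell s a = inp a) /\ grid_stored D K Z s.

Definition Tof (s : state) (i a : nat) : nat := cell s (Z + 4 * (i * M + a) + 1).
Definition Wof (s : state) (i a : nat) : nat := cell s (Z + 4 * (i * M + a) + 2).
Definition want_of (s : state) (i : nat) : nat := cell s (Z + 4 * i + 3).

Lemma setup_ends s :
  bounded W s -> reg s rm = m -> cell s =1 inp ->
  ends W L (setup_cmd c) s (fun s' =>
    [/\ consts s', base s' & forall i a, Tof s' i a = 0]).
Proof.
move=> bs sm sc; have [bR bC] := bs.
have nW : n.+1 <= W by nia.
have ZW : Z <= W by lia.
have NW : N <= W by apply: leq_trans (W_N 1); rewrite inp1 leq_pmulr.
have KW : K <= W by lia.
have hK : h.+1 <= K.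
  have : 0 < h by [].
  rewrite /grid_size /grid_den; nia.
have DK : D <= K.
  by rewrite /grid_size; apply: leq_trans (leq_addr _ _); rewrite leq_pmulr.
apply: (@ends_seq_assignE _ _ n) => //; [by rewrite /= sc|lia|].
set s1 := assigned _ _ _ => b1.
apply: (@ends_seq_assignE _ _ B) => //; first by rewrite /= sc.
  by rewrite -inp2 -sc.
set s2 := assigned _ _ _ => b2.
apply: (@ends_seq_assignE _ _ Z) => //; first by rewrite /= /update /= sm.
set s3 := assigned _ _ _ => b3.
apply: (@ends_seq_assignE _ _ N) => //.
set s4 := assigned _ _ _ => b4.
apply: (@ends_seq_assignE _ _ 0) => //.
set s5 := assigned _ _ _ => b5.
apply: (@ends_seq_assignE _ _ 1) => //; first by lia.
set s6 := assigned _ _ _ => b6.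
(* After h doublings the body is idle; n iterations suffice because n < 2 ^ n gives h <= n. *)
pose Inv k s' := [/\ agree [:: rp; rh; rt] s6 s', reg s' rp = 2 ^ minn k h
                   & reg s' rh = minn k h].
apply: (@ends_seq _ _ _ _ _ (Inv n)).
  apply: (@ends_for _ _ _ _ _ _ n Inv) => //; [lia|lia|..].
  - by move=> k s' [[_ ag] _ _]; rewrite /= ag.
  - by split; rewrite ?min0n //; apply: agree_assigned.
  - move=> k s' lt_k bs' xk [ag p' h']; have [agc agr] := ag.
    have n' : reg s' rn = n by rewrite agr.
    have [lt_kh|ge_kh] := ltnP k h.
      have le_n : 2 ^ k <= n by rewrite -bitlen_gtP.
      have kE : minn k h = k by lia.
      have k1E : minn k.+1 h = k.+1 by lia.
      rewrite kE in p' h'.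
      apply: ends_if => //=; last by rewrite n' p'; lia.
      move=> _; apply: (@ends_seq_assignE _ _ (2 ^ k.+1)) => //.
      * by rewrite /= p' mulnC -expnS.
      * apply: leq_trans (_ : 2 * n <= _); first by rewrite expnS leq_mul2l le_n.
        by have := leq_pmulr n n0; have := W_n; rewrite -mulnA; lia.
      set s7 := assigned _ _ _ => b7.
      apply: (@ends_assignE _ _ k.+1) => //.
      * by rewrite /= /update /= h' addn1.
      * by lia.
      split=> //; split; rewrite /Inv ?k1E //.
      by do 3!apply: agree_assigned => //.
    have kE : minn k h = h by lia.
    have k1E : minn k.+1 h = h by lia.
    rewrite kE in p' h'.
    apply: ends_if => //=; first by rewrite n' p'; lia.
    move=> _; apply: ends_skip => //; split=> //; split; rewrite /Inv ?k1E //.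
    exact: agree_assigned.
move=> s7 b7 [ag7]; have -> : minn n h = h.
  by apply/minn_idPr/bitlen_leW => //; apply: ltn_expl.
move=> p7 h7; have [agc7 agr7] := ag7.
apply: (@ends_seq_assignE _ _ D) => //; first by rewrite /= h7 addn1.
  exact: leq_trans KW.
set s8 := assigned _ _ _ => b8.
apply: (@ends_seq_assignE _ _ K) => //; first by rewrite /= /update /= h7.
set s9 := assigned _ _ _ => b9.
apply: (@ends_seq_assignE _ _ 0) => //.
set s10 := assigned _ _ _ => b10.
have regs10 x : x < 7 -> reg s10 x = nth 0 [:: m; n; B; Z; N; D; K] x.
  by case: x => [|[|[|[|[|[|[|]]]]]]] //= _; rewrite /update /= agr7.
have cell10 : cell s10 =1 inp by move=> a; rewrite /= agc7 /=.
pose Inv' k s' := [/\ forall x, x < 7 -> reg s' x = reg s10 x,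
  reg s' rg = grid D k,
  forall k', k' < k -> cell s' (Z + 4 * k') = grid D k',
  forall a, a < Z -> cell s' a = inp a
  & forall i a, Tof s' i a = 0].
apply: (@ends_seq _ _ _ _ _ (Inv' K)).
  apply: (@ends_for _ _ _ _ _ _ K Inv') => //; [lia|..].
  - by move=> k s' [rgs _ _ _ _]; rewrite /= rgs // regs10.
  - split=> //; first by case=> [|[|[|[|[|[|[|]]]]]]].
      by move=> a _; exact: cell10.
    by move=> i a; rewrite /Tof -[LHS]/(cell s10 _) cell10 inpZ //; lia.
  - move=> k s' lt_k bs' xk [rgs gk gs ins Ts].
    have gW : grid D k.+1 <= W.
      have := grid_lt D k.+1; have : 2 ^ k.+1 <= 2 ^ K by rewrite leq_exp2l.
      by lia.
    apply: (@ends_seq_storeE _ _ (Z + 4 * k) (grid D k)) => //.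
    + by rewrite /= rgs // regs10 //= xk addn0.
    + by have := bs'.1 rg; rewrite gk.
    set s11 := stored _ _ _ => b11.
    apply: (@ends_assignE _ _ (grid D k.+1)) => //.
    + by rewrite /= gk rgs // regs10.
    split=> //; split=> //=.
    + by case=> [|[|[|[|[|[|[|]]]]]]] // _; rewrite /update /= rgs.
    + move=> k'; rewrite ltnS /update => le_k'.
      case: eqP => [e|ne]; first by have -> : k' = k by lia.
      by apply: gs; lia.
    + by move=> a lt_a; rewrite /update; case: eqP => [|_]; [lia | apply: ins].
    + by move=> i a; rewrite /Tof /= /update; case: eqP => [|_]; [lia | apply: Ts].
move=> s11 b11 [rgs _ gs ins Ts].
apply: ends_seq.
  apply: (@key_ends _ _ D K Z m _ _ _ _ _ _ _ (fun=> 0)) => //.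
  - by lia.
  - by lia.
  - by rewrite -/M; lia.
  - by rewrite rgs // regs10.
  - by rewrite rgs // regs10.
  - by rewrite rgs // regs10.
move=> s12 b12 [[agc12 agr12] p12 _].
apply: (@ends_assignE _ _ M) => //; first by lia.
split.
- move=> x; rewrite ltnS leq_eqVlt => /orP[/eqP ->|lt_x] //.
  rewrite /= /update ltn_eqF // agr12 ?rgs ?regs10 //; last first.
    by move: lt_x; do 7!case: x => [//|x].
  by move: lt_x; do 7!case: x => [//|x].
- by split=> a lt_a /=; rewrite agc12; [apply: ins | apply: gs].
- by move=> i a; rewrite /Tof /= agc12; apply: Ts.
Qed.

Lemma key_run s e vf :
  bounded W s -> consts s -> grid_stored D K Z s ->
  (forall s' i, i < m -> agree key_regs s s' -> consts s' -> reg s' rc = i ->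
     reg s' rp = K ^ i -> eval s' e = vf i /\ vf i <= W) ->
  ends W L (key_cmd e) s (fun s' =>
    [/\ agree key_regs s s', consts s' & reg s' rres = key_of m C c h vf]).
Proof.
move=> bs cs gs ev.
have cs' s' : agree key_regs s s' -> consts s'.
  by move=> ag; apply: consts_agree ag cs.
apply: ends_weaken (@key_ends W L D K Z m _ _ _ _ _ s e vf bs _ _ _ gs _).
- by move=> s' _ [ag _ res]; split=> //; apply: cs'.
- exact: K0.
- by lia.
- by lia.
- by [].
- by rewrite -/M; lia.
- by rewrite cs.
- by rewrite cs.
- by rewrite cs.
- by move=> s' i lt_i ag; apply: ev => //; apply: cs'.
Qed.

Lemma eval_mod s a b : eval s (mod_expr a b) = eval s a %% eval s b.
Proof. by rewrite /= {1}(divn_eq (eval s a) (eval s b)) addKn. Qed.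

Lemma eval_key_val s a i :
  consts s -> grid_stored D K Z s -> reg s rp = K ^ i ->
  eval s (key_val_expr a) = key_val C c h (eval s a) i.
Proof.
move=> cs gs p; rewrite [LHS]/= -[eval s a %/ _ - _]/(eval s (mod_expr (Div a (Reg rp)) (Reg rK))).
by rewrite eval_mod /= p !cs //= addn0 gs ?ltn_mod.
Qed.

Lemma eval_table s b i a :
  consts s -> eval s (table (Const b) i a) = Z + 4 * (eval s i * M + eval s a) + b.
Proof. by move=> cs; rewrite /= !cs. Qed.

Lemma eval_slot s b x :
  consts s -> eval s (slot (Const b) x) = Z + 4 * eval s x + b.
Proof. by move=> cs; rewrite /= !cs. Qed.

Lemma table_inj i a j b : a < M -> b < M ->
  (j * M + b == i * M + a) = (j == i) && (b == a).
Proof.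
move=> lt_a lt_b; apply/eqP/andP => [e|[/eqP -> /eqP ->] //].
have q x y : y < M -> (x * M + y) %/ M = x.
  by move=> lt; rewrite divnMDl // divn_small // addn0.
have ji : j = i by rewrite -(q j b) // e q.
by split; apply/eqP => //; move: e; rewrite ji => /addnI.
Qed.

Lemma Tof_stored s i a v j b : a < M -> b < M ->
  Tof (stored s (Z + 4 * (i * M + a) + 1) v) j b =
    if (j == i) && (b == a) then v else Tof s j b.
Proof.
move=> lt_a lt_b; rewrite -table_inj // /Tof /= /update.
by rewrite eqn_add2r eqn_add2l eqn_mul2l.
Qed.

Lemma Wof_stored s i a v j b : a < M -> b < M ->
  Wof (stored s (Z + 4 * (i * M + a) + 2) v) j b =
    if (j == i) && (b == a) then v else Wof s j b.
Proof.
move=> lt_a lt_b; rewrite -table_inj // /Wof /= /update.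
by rewrite eqn_add2r eqn_add2l eqn_mul2l.
Qed.

Lemma Tof_stored_other s x b v i a : b < 4 -> b != 1 ->
  Tof (stored s (Z + 4 * x + b) v) i a = Tof s i a.
Proof. by move=> lt_b ne_b; rewrite /Tof /= /update; case: eqP => //; lia. Qed.

Lemma Wof_stored_other s x b v i a : b < 4 -> b != 2 ->
  Wof (stored s (Z + 4 * x + b) v) i a = Wof s i a.
Proof. by move=> lt_b ne_b; rewrite /Wof /= /update; case: eqP => //; lia. Qed.

Lemma base_stored s x b v : 0 < b < 4 -> base s -> base (stored s (Z + 4 * x + b) v).
Proof.
move=> lt_b [ins gs]; split=> a lt_a /=; rewrite /update.
  by case: eqP => [|_]; [lia | apply: ins].
by case: eqP => [|_]; [lia | apply: gs].
Qed.

Local Notation leaf_ok := (leaf_ok m n C c h r S).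

Lemma leaf_ok_ext (T T' : nat -> nat -> nat) j :
  (forall a, a < M -> T' (n + j) a = T (n + j) a) -> leaf_ok T j -> leaf_ok T' j.
Proof.
move=> eT [e1 e2 e3 e4]; split; rewrite ?eT ?key_of_lt //.
  by move=> b lt_b; rewrite eT //; apply: e3.
by move=> b lt_b; rewrite eT //; apply: e4.
Qed.

Lemma leaves_ends s :
  bounded W s -> consts s -> base s -> (forall i a, Tof s i a = 0) ->
  ends W L leaves_cmd s (fun s' =>
    [/\ consts s', base s', forall j, j < n -> leaf_ok (Tof s') j
      & forall i a, i < n -> a < M -> Tof s' i a = 0]).
Proof.
move=> bs cs bas T0.
pose Inv k s' := [/\ consts s', base s',
  forall j, j < k -> leaf_ok (Tof s') j
  & forall i a, (i < n) || (n + k <= i) -> a < M -> Tof s' i a = 0].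
apply: (@ends_for _ _ _ _ _ _ n Inv) => //; [lia|lia|..].
- by move=> k s' [cs' _ _ _]; rewrite /= cs'.
- by split=> //; [apply: consts_assigned | move=> i a _ _; apply: T0].
- move=> j s1 lt_j bs1 xj [cs1 bas1 lv1 z1]; have [ins1 gs1] := bas1.
  apply: (@ends_seq _ _ _ _ _ _).
    apply: (@key_run _ _ (leaf_val n C r S j)) => //.
    move=> s' i lt_i [agc agr] cs' xi p'.
    have lt_a : 3 + m + j * m + i < Z by nia.
    have -> : eval s' leaf_expr = leaf_val n C r S j i.
      by rewrite /= agc xi [reg s' rt]agr // xj !cs' //= !ins1 //; lia.
    split=> //; apply: leq_trans (leq_div _ _) _; rewrite mulnC; exact: W_N.
  move=> s2 b2 [[agc2 agr2] cs2 res2].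
  have lt_k := key_of_lt m C c h (leaf_val n C r S j).
  set a := key_of _ _ _ _ _ in res2 lt_k.
  have t2 : reg s2 rt = j by rewrite agr2.
  have n2 : reg s2 rn = n by rewrite cs2.
  apply: (@ends_seq_storeE _ _ (Z + 4 * ((n + j) * M + a) + 1) n) => //.
  + by rewrite eval_table //= t2 n2 res2.
  + by lia.
  set s3 := stored _ _ _ => b3.
  apply: (@ends_storeE _ _ (Z + 4 * ((n + j) * M + 0) + 1) n.+1) => //.
  + by rewrite eval_table //= t2 n2.
  + by rewrite /= n2 addn1.
  + by lia.
  set s4 := stored _ _ _; split=> //.
  have T4 i b : b < M -> Tof s4 i b = if i == n + j then
      (if b == 0 then n.+1 else if b == a then n else 0) else Tof s1 i b.
    move=> lt_b; rewrite Tof_stored // Tof_stored //.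
    have -> : Tof s2 i b = Tof s1 i b by rewrite /Tof agc2.
    case: eqP => [->|//] /=; case: eqP => // _; case: eqP => // _.
    by apply: z1; rewrite ?leqnn ?orbT.
  split.
  + by apply: consts_assigned.
  + have bas2 : base s2 by rewrite /base /grid_stored agc2.
    by apply: (@base_stored s3) => //; apply: base_stored.
  + move=> i; rewrite ltnS leq_eqVlt => /orP[/eqP ->|lt_i].
      split.
      * by rewrite [Tof _ _ _]T4 // eqxx.
      * rewrite -/a [Tof _ _ _]T4 // eqxx; by case: eqP => _; rewrite ?eqxx ?leqnSn.
      * move=> b lt_b; rewrite [Tof _ _ _]T4 // eqxx; do 2!case: eqP => // _; lia.
      * move=> b lt_b; rewrite [Tof _ _ _]T4 // eqxx -/a.
        case: eqP => [->|_]; first by left.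
        by case: eqP => [->|//]; right.
    have T1 b : b < M -> Tof (assigned s4 rt j.+1) (n + i) b = Tof s1 (n + i) b.
      by move=> lt_b; rewrite [LHS]T4 //; case: eqP => //; lia.
    exact: leaf_ok_ext T1 (lv1 i lt_i).
  + move=> i b hi lt_b; rewrite [LHS]T4 //; case: eqP => [|_]; first by lia.
    by apply: z1 => //; lia.
- by move=> s' bs' _ [cs' bas' lv' z']; split=> // i a lt_i; apply: z'; rewrite lt_i.
Qed.

Local Notation merge_val := (merge_val m C c h).
Local Notation key_of := (key_of m C c h).
Local Notation merged := (merged m n C c h).

Lemma key_lt q : q < M * M -> [/\ q %/ M < M, q %% M < M & key_of (merge_val q) < M].
Proof. by move=> lt_q; rewrite ltn_divLR // ltn_mod M0 key_of_lt. Qed.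

(** The children of i have larger indices, so later writes at smaller nodes do not disturb the table
    of i. *)
Lemma merged_ext (T V T' V' : nat -> nat -> nat) i k :
  (forall j a, i <= j -> a < M -> T' j a = T j a) ->
  (forall a, a < M -> V' i a = V i a) ->
  k <= M * M -> merged T V i k -> merged T' V' i k.
Proof.
move=> eT eV le_k [ub snd cpl]; split=> [a lt_a|a lt_a|q lt_q].
- by rewrite eT // ub.
- rewrite eT // => T0; have [lt_V aE TE] := snd a lt_a T0.
  have [lt1 lt2 _] := key_lt lt_V.
  by rewrite eV // !eT //; lia.
- have [lt1 lt2 lt3] := key_lt (leq_trans lt_q le_k).
  by rewrite !eT ?cpl //; lia.
Qed.

Lemma merged_skip T V i q :
  T i.*2 (q %/ M) + T i.*2.+1 (q %% M) - n.+1 <= T i (key_of (merge_val q)) ->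
  merged T V i q -> merged T V i q.+1.
Proof.
move=> le_T [ub snd cpl]; split=> // q'; rewrite ltnS leq_eqVlt.
by case/orP=> [/eqP ->|/cpl].
Qed.

(** Earlier pairs with the same key stay dominated because the score only grows, and the tables of
    the children do not change since i > 0. *)
Lemma merged_step (T V T' V' : nat -> nat -> nat) i q
    (v := T i.*2 (q %/ M) + T i.*2.+1 (q %% M) - n.+1)
    (a := key_of (merge_val q)) :
  0 < i -> q < M * M -> v <= n.+1 -> T i a < v ->
  (forall j b, b < M -> T' j b = if (j == i) && (b == a) then v else T j b) ->
  (forall j b, b < M -> V' j b = if (j == i) && (b == a) then q else V j b) ->
  merged T V i q -> merged T' V' i q.+1.
Proof.
move=> i0 lt_q le_v lt_v eT eV [ub snd cpl].
have T2 b : b < M -> T' i.*2 b = T i.*2 b.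
  by move=> lt_b; rewrite eT //; case: eqP => //; lia.
have T21 b : b < M -> T' i.*2.+1 b = T i.*2.+1 b.
  by move=> lt_b; rewrite eT //; case: eqP => //; lia.
have [lt1 lt2 lt3] := key_lt lt_q.
split=> [b lt_b|b lt_b|q' le_q'].
- by rewrite eT // eqxx; case: eqP => // _; apply: ub.
- rewrite eT // eV // eqxx /=; case: eqP => [->|_].
    by move=> _; rewrite T2 // T21.
  move=> T0; have [lt_V bE TE] := snd b lt_b T0.
  by have [l1 l2 _] := key_lt lt_V; rewrite T2 // T21.
- have [l1 l2 l3] := key_lt (leq_trans le_q' lt_q).
  rewrite T2 // T21 // eT // eqxx /=; case: eqP => [e|ne].
    move: le_q'; rewrite ltnS leq_eqVlt => /orP[/eqP -> //|/cpl].
    by rewrite e -/a; lia.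
  move: le_q'; rewrite ltnS leq_eqVlt => /orP[/eqP qE|/cpl //].
  by rewrite qE in ne.
Qed.

Lemma key_val_lt a i : key_val C c h a i < 2 ^ K.
Proof.
apply: leq_trans (grid_lt _ _) _; rewrite leq_exp2l // ltnW //.
by rewrite ltn_mod.
Qed.

Let W_K : 2 * 2 ^ K <= W.
Proof.
have := W_ge 1; rewrite inp1; apply: leq_trans; rewrite leq_mul2r.
by apply/orP; right; nia.
Qed.

Lemma merge_node_ends s i :
  bounded W s -> consts s -> base s -> reg s ri = i -> 0 < i < n ->
  (forall a, a < M -> Tof s i.*2 a <= n.+1) ->
  (forall a, a < M -> Tof s i.*2.+1 a <= n.+1) ->
  (forall a, a < M -> Tof s i a = 0) ->
  ends W L merge_node_cmd s (fun s' => [/\ consts s', base s', reg s' rt = reg s rt,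
       forall j a, j != i -> a < M -> Tof s' j a = Tof s j a /\ Wof s' j a = Wof s j a
     & merged (Tof s') (Wof s') i (M * M)]).
Proof.
move=> bs cs bas si /andP[i0 lt_i] ub2 ub21 Ti0.
pose Inv q s' := [/\ consts s', base s', reg s' ri = i /\ reg s' rt = reg s rt,
   forall j a, j != i -> a < M -> Tof s' j a = Tof s j a /\ Wof s' j a = Wof s j a
 & merged (Tof s') (Wof s') i q].
apply: (@ends_for _ _ _ _ _ _ (M * M) Inv) => //; [lia|lia|..].
- by move=> k s' [cs' _ _ _ _]; rewrite /= !cs'.
- split=> //; first exact: consts_assigned.
  by split=> // a lt_a; rewrite [Tof _ _ _]Ti0.
- move=> q s1 lt_q bs1 xq [cs1 bas1 [i1 t1] fr1 mg1]; have [ins1 gs1] := bas1.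
  have [lt1 lt2 lt3] := key_lt lt_q.
  apply: (@ends_seq _ _ _ _ _ _).
    apply: (@key_run _ _ (merge_val q)) => //.
    move=> s' k lt_k [agc agr] cs' xk p'.
    have gs' : grid_stored D K Z s' by rewrite /grid_stored agc.
    have q' : reg s' rq = q by rewrite agr.
    have M' : reg s' rM = M by rewrite cs'.
    split.
      by rewrite -[LHS]/(eval s' (key_val_expr (Div (Reg rq) (Reg rM))) +
        eval s' (key_val_expr (mod_expr (Reg rq) (Reg rM))))
        !(@eval_key_val _ _ k) // eval_mod /= q' M'.
    have := key_val_lt (q %/ M) k; have := key_val_lt (q %% M) k.
    rewrite -[merge_val q k]/(key_val C c h (q %/ M) k + key_val C c h (q %% M) k).
    by lia.
  move=> s2 b2 [[agc2 agr2] cs2 res2].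
  set a := key_of _ in res2 lt3.
  have q2 : reg s2 rq = q by rewrite agr2.
  have M2 : reg s2 rM = M by rewrite cs2.
  have n2 : reg s2 rn = n by rewrite cs2.
  have i2 : reg s2 ri = i by rewrite agr2.
  have T12 : Tof s2 = Tof s1 by rewrite /Tof agc2.
  have W12 : Wof s2 = Wof s1 by rewrite /Wof agc2.
  pose v := Tof s2 i.*2 (q %/ M) + Tof s2 i.*2.+1 (q %% M) - n.+1.
  have le_v : v <= n.+1.
    have ne2 : i.*2 != i by lia.
    have ne21 : i.*2.+1 != i by lia.
    rewrite /v T12; have [-> _] := fr1 _ _ ne2 lt1; have [-> _] := fr1 _ _ ne21 lt2.
    by have := ub2 _ lt1; have := ub21 _ lt2; lia.
  apply: (@ends_seq_assignE _ _ v) => //.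
  + rewrite -[LHS]/(
      cell s2 (eval s2 (table (Const 1) left_expr (Div (Reg rq) (Reg rM)))) +
      cell s2 (eval s2 (table (Const 1) right_expr (mod_expr (Reg rq) (Reg rM)))) -
      (reg s2 rn + 1)).
    by rewrite !eval_table // eval_mod /= q2 M2 n2 i2 mul2n (addn1 n) (addn1 i.*2).
  + by lia.
  set s3 := assigned _ _ _ => b3.
  have cs3 : consts s3 by apply: consts_assigned.
  have e3 : eval s3 (Sub (Reg rs) (Fetch (table (Const 1) (Reg ri) (Reg rres)))) =
      v - Tof s2 i a.
    rewrite -[LHS]/(v - cell s3 (eval s3 (table (Const 1) (Reg ri) (Reg rres)))).
    by rewrite eval_table //= /update /= i2 res2.
  have ea b : eval s3 (table (Const b) (Reg ri) (Reg rres)) = Z + 4 * (i * M + a) + b.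
    by rewrite eval_table //= /update /= i2 res2.
  have bas2 : base s2 by rewrite /base /grid_stored agc2.
  apply: ends_if => //; rewrite e3 => ne.
    have lt_v : Tof s2 i a < v by lia.
    apply: (@ends_seq_storeE _ _ (Z + 4 * (i * M + a) + 1) v) => //; first by lia.
    set s4 := stored _ _ _ => b4.
    apply: (@ends_storeE _ _ (Z + 4 * (i * M + a) + 2) q) => //.
    * by rewrite -[LHS]/(eval s3 (table (Const 2) (Reg ri) (Reg rres))) ea.
    * by lia.
    set s5 := stored _ _ _.
    have T5 j b : b < M -> Tof s5 j b = if (j == i) && (b == a) then v else Tof s2 j b.
      by move=> lt_b; rewrite Tof_stored_other // Tof_stored.
    have W5 j b : b < M -> Wof s5 j b = if (j == i) && (b == a) then q else Wof s2 j b.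
      by move=> lt_b; rewrite Wof_stored // [Wof s4 _ _]Wof_stored_other.
    split=> //; split.
    * by apply: consts_assigned.
    * by apply: (@base_stored s4) => //; apply: (@base_stored s3).
    * by split=> //; rewrite -t1 -[RHS]agr2.
    * move=> j b ne_j lt_b; rewrite [Tof _ _ _]T5 // [Wof _ _ _]W5 //.
      by rewrite (negbTE ne_j) /= T12 W12; apply: fr1.
    * by apply: (merged_step i0 lt_q le_v lt_v T5 W5); rewrite T12 W12.
  apply: ends_skip => //; split=> //; split.
  * by apply: consts_assigned.
  * exact: bas2.
  * by split=> //; rewrite -t1 -[RHS]agr2.
  * move=> j b ne_j lt_b; rewrite -![Tof _ _ _]/(Tof s2 j b) -![Wof _ _ _]/(Wof s2 j b).
    by rewrite T12 W12; apply: fr1.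
  * have mg2 : merged (Tof s2) (Wof s2) i q by rewrite T12 W12.
    by apply: merged_skip mg2; rewrite -/v -/a; lia.
- by move=> s' bs' _ [cs' bas' [_ t'] fr' mg']; split.
Qed.

Definition filled (s : state) : Prop :=
  (forall j, j < n -> leaf_ok (Tof s) j) /\
  (forall i, 0 < i < n -> merged (Tof s) (Wof s) i (M * M)).

Lemma merge_ends s :
  bounded W s -> consts s -> base s ->
  (forall j, j < n -> leaf_ok (Tof s) j) ->
  (forall i a, i < n -> a < M -> Tof s i a = 0) ->
  ends W L merge_cmd s (fun s' => [/\ consts s', base s' & filled s']).
Proof.
move=> bs cs bas lv z.
pose Inv t s' := [/\ consts s', base s',
  forall j, j < n -> leaf_ok (Tof s') j,
  forall i, n - 1 - t < i < n -> merged (Tof s') (Wof s') i (M * M)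
  & forall i a, i <= n - 1 - t -> a < M -> Tof s' i a = 0].
apply: (@ends_for _ _ _ _ _ _ (n - 1) Inv) => //; [lia|lia|..].
- by move=> k s' [cs' _ _ _ _]; rewrite /= cs'.
- split=> //; [exact: consts_assigned|by lia|].
  by move=> i a le_i; apply: z; lia.
- move=> t s1 lt_t bs1 xt [cs1 bas1 lv1 mg1 z1].
  pose i := n - 1 - t.
  apply: (@ends_seq_assignE _ _ i) => //.
  + by rewrite /= cs1 // xt.
  + by rewrite /i; lia.
  set s2 := assigned _ _ _ => b2.
  have ubT j a : i < j < n.*2 -> a < M -> Tof s2 j a <= n.+1.
    move=> bj lt_a; have [le|lt] := leqP n j.
      have -> : j = n + (j - n) by lia.
      have lt_j : j - n < n by lia.
      by have [_ _ ub _] := lv1 _ lt_j; apply: ub.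
    have bj' : n - 1 - t < j < n by rewrite -/i; lia.
    by have [ub _ _] := mg1 _ bj'; apply: ub.
  apply: ends_weaken (@merge_node_ends s2 i b2 _ _ _ _ _ _ _) => //.
  + move=> s3 b3 [cs3 bas3 t3 fr3 mg3].
    split; first by rewrite t3 /= /update /=.
    split.
    * exact: consts_assigned.
    * exact: bas3.
    * move=> j lt_j; apply: leaf_ok_ext (lv1 j lt_j) => a lt_a.
      have ne : n + j != i by rewrite /i; lia.
      by have [e _] := fr3 _ _ ne lt_a.
    * move=> j bj; have [->|ne] := eqVneq j i; first exact: mg3.
      have bj' : n - 1 - t < j < n by move: ne; rewrite /i; lia.
      apply: merged_ext (mg1 j bj') => // [k a le_k lt_a|a lt_a].
        have ne' : k != i by move: bj'; rewrite /i; lia.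
        by have [e _] := fr3 _ _ ne' lt_a.
      by have [_ e] := fr3 _ _ ne lt_a.
    * move=> j a le_j lt_a; have ne : j != i by rewrite /i; lia.
      have [e _] := fr3 _ _ ne lt_a.
      by rewrite [LHS]e; apply: z1 => //; lia.
  + exact: consts_assigned.
  + by rewrite /i; lia.
  + by move=> a lt_a; apply: ubT => //; rewrite /i; lia.
  + by move=> a lt_a; apply: ubT => //; rewrite /i; lia.
  + by move=> a lt_a; apply: z1.
- move=> s' bs' _ [cs' bas' lv' mg' _]; split=> //; split=> // i bi.
  by apply: mg'; lia.
Qed.

Local Notation passes := (passes m n B C c h r).

Definition pick_regs := rs :: rpick :: rt :: key_regs.

(** The existence of a passing key is a premise inside the postcondition, because the program must
    also halt in time on instances without an exact solution. *)
Lemma pick_ends s :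
  bounded W s -> consts s -> base s ->
  ends W L (pick_cmd c) s (fun s' =>
    [/\ agree pick_regs s s', reg s' rpick < M &
        (exists2 a, a < M & passes (Tof s) a) -> passes (Tof s) (reg s' rpick)]).
Proof.
move=> bs cs bas.
apply: (@ends_seq_assignE _ _ 0) => // b0.
pose Inv k s' := [/\ agree pick_regs s s', reg s' rpick < M &
  (exists2 a, a < k & passes (Tof s) a) -> passes (Tof s) (reg s' rpick)].
have cI k s' : Inv k s' -> consts s' by case=> ag _ _; apply: consts_agree ag cs.
apply: (@ends_for _ _ _ _ _ _ M Inv) => //; [lia|lia|..].
- by move=> k s' /cI cs'; rewrite /= cs'.
- by split=> //; [do 2!apply: agree_assigned => // | case].
move=> a s1 lt_a bs1 xa I1; have cs1 := cI _ _ I1; have [ag1 lt1 ps1] := I1.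
have bas1 : base s1 by rewrite /base /grid_stored ag1.1.
apply: (@ends_seq _ _ _ _ _ _).
  apply: (@key_run _ _ (test_val n C c h r a)) => //; first by case: bas1.
  move=> s' i lt_i [agc agr] cs' xi p'.
  have gs' : grid_stored D K Z s' by rewrite /grid_stored agc; case: bas1.
  have t' : reg s' rt = a by rewrite agr.
  have r' : cell s' (3 + i) = inp (3 + i) by rewrite agc; apply: bas1.1; lia.
  split.
    rewrite -[LHS]/((2 * reg s' rN * cell s' (3 + reg s' rc) + 1 -
      C * (reg s' rN - eval s' (key_val_expr (Reg rt))) * cell s' (3 + reg s' rc)) *
      cell s' (eval s' (slot (Const 0) (Sub (Reg rK) (Const 1))))).
    rewrite (@eval_key_val _ _ i) // eval_slot //= xi r' t' !cs' //= addn0.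
    by rewrite gs' //; lia.
  apply: leq_trans (W_ge (3 + i)); apply: leq_mul; first by lia.
  have kK : K - 1 <= K by lia.
  by apply: leq_trans (ltnW (grid_lt _ _)) _; rewrite leq_exp2l.
move=> s2 b2 [ag2 cs2 res2].
have ag2' : agree pick_regs s s2 by apply: agree_trans ag1 ag2.
have [agc2 agr2] := ag2.
have t2 : reg s2 rt = a by rewrite agr2.
have T2 : Tof s2 = Tof s by rewrite /Tof ag2'.1.
have pick2 : reg s2 rpick = reg s1 rpick by rewrite agr2.
apply: (@ends_seq_assignE _ _ (Tof s 1 a)) => //.
- by rewrite -[LHS]/(cell s2 (eval s2 (table (Const 1) (Const 1) (Reg rt))))
    eval_table //= t2 -T2.
- by rewrite -T2; apply: b2.2.
set s3 := assigned _ _ _ => b3.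
have ag3 : agree pick_regs s s3 by apply: agree_assigned.
have skip : ~ passes (Tof s) a -> ends W L Skip s3 (fun s' =>
    reg s' rt = a /\ Inv a.+1 (assigned s' rt a.+1)).
  move=> np; apply: ends_skip => //; split; first by rewrite -t2.
  split; [exact: agree_assigned | by rewrite -[reg _ _]/(reg s2 rpick) pick2 |].
  case=> a'; rewrite ltnS leq_eqVlt => /orP[/eqP -> //|lt_a'] pa'.
  by rewrite -[reg _ _]/(reg s2 rpick) pick2; apply: ps1; exists a'.
have lt_k := key_of_lt m C c h (test_val n C c h r a).
have n2 : reg s2 rn = n by rewrite cs2.
have M2 : reg s2 rM = M by rewrite cs2.
have B2 : reg s2 rB = B by rewrite cs2.
apply: ends_if => //= [T0|T0]; last first.
  by apply: skip; case; move: T0; rewrite /update /= => ->.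
apply: ends_if => //=; rewrite /update /= M2 res2 => e1.
  by apply: skip; case=> _ _; lia.
apply: ends_if => //=; rewrite /update /= n2 B2 => e2.
  by apply: skip; case=> _ + _; move: e2; rewrite /update /=; lia.
apply: (@ends_assignE _ _ a) => //; first by lia.
split; first by rewrite -t2.
split; first by do 2!apply: agree_assigned => //.
  by [].
move=> _; split; rewrite -[reg _ _]/a.
- by move: T0; rewrite /update /=; lia.
- by move: e2; rewrite /update /=; lia.
- by lia.
Qed.

Definition traced (s : state) : Prop := forall i, 0 < i < n ->
  want_of s i.*2 = Wof s i (want_of s i) %/ M /\
  want_of s i.*2.+1 = Wof s i (want_of s i) %% M.

Lemma want_of_stored s x v i :
  want_of (stored s (Z + 4 * x + 3) v) i = if i == x then v else want_of s i.
Proof. by rewrite /want_of /= /update eqn_add2r eqn_add2l eqn_mul2l. Qed.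

Lemma trace_ends s :
  bounded W s -> consts s ->
  ends W L trace_cmd s (fun s' =>
    [/\ consts s', forall i a, Tof s' i a = Tof s i a,
        forall i a, Wof s' i a = Wof s i a,
        want_of s' 1 = reg s rpick & traced s']).
Proof.
move=> bs cs.
apply: (@ends_seq_storeE _ _ (Z + 4 * 1 + 3) (reg s rpick)) => //.
- by rewrite eval_slot.
- exact: bs.1.
set s0 := stored _ _ _ => b0.
pose Inv k s' := [/\ consts s', forall i a, Tof s' i a = Tof s i a,
  forall i a, Wof s' i a = Wof s i a, want_of s' 1 = reg s rpick
  & forall i, 0 < i <= k ->
      want_of s' i.*2 = Wof s' i (want_of s' i) %/ M /\
      want_of s' i.*2.+1 = Wof s' i (want_of s' i) %% M].
apply: (@ends_for _ _ _ _ _ _ (n - 1) Inv) => //; [lia|lia|..].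
- by move=> k s' [cs' _ _ _ _]; rewrite /= cs'.
- split; first exact: consts_assigned.
  + by move=> i a; apply: (@Tof_stored_other s 1 3).
  + by move=> i a; apply: (@Wof_stored_other s 1 3).
  + by rewrite -[LHS]/(want_of s0 1) want_of_stored.
  + by lia.
- move=> t s1 lt_t bs1 xt [cs1 T1 W1 w1 tr1].
  pose i := t.+1.
  apply: (@ends_seq_assignE _ _ i) => //; [by rewrite /= xt addn1|by rewrite /i; lia|].
  set s2 := assigned _ _ _ => b2.
  have cs2 : consts s2 by apply: consts_assigned.
  pose q := Wof s1 i (want_of s1 i).
  apply: (@ends_seq_assignE _ _ q) => //.
  + rewrite -[LHS]/(cell s2 (eval s2
      (table (Const 2) (Reg ri) (Fetch (slot (Const 3) (Reg ri)))))).
    rewrite eval_table // -[eval s2 (Fetch _)]/(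
      cell s2 (eval s2 (slot (Const 3) (Reg ri)))).
    by rewrite eval_slot.
  + exact: bs1.2.
  set s3 := assigned _ _ _ => b3.
  have cs3 : consts s3 by apply: consts_assigned.
  have M3 : reg s3 rM = M by rewrite cs3.
  have qW : q <= W by apply: bs1.2.
  apply: (@ends_seq_storeE _ _ (Z + 4 * i.*2 + 3) (q %/ M)) => //.
  + by rewrite eval_slot //= /update /= mul2n.
  + by rewrite -[LHS]/(q %/ reg s3 rM) M3.
  + exact: leq_trans (leq_div _ _) qW.
  set s4 := stored _ _ _ => b4.
  have cs4 : consts s4 by exact: cs3.
  apply: (@ends_storeE _ _ (Z + 4 * i.*2.+1 + 3) (q %% M)) => //.
  + by rewrite eval_slot //= /update /= mul2n addn1.
  + by rewrite eval_mod -[eval s4 (Reg rM)]/(reg s3 rM) M3.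
  + exact: leq_trans (leq_mod _ _) qW.
  set s5 := stored _ _ _; split; first by [].
  have w5 j : want_of s5 j = if j == i.*2.+1 then q %% M else
      if j == i.*2 then q %/ M else want_of s1 j.
    by rewrite want_of_stored want_of_stored.
  have W5 j a : Wof s5 j a = Wof s1 j a.
    by rewrite !Wof_stored_other.
  split.
  + by apply: consts_assigned.
  + by move=> j a; rewrite [LHS]Tof_stored_other // [LHS]Tof_stored_other // [LHS]T1.
  + by move=> j a; rewrite [LHS]W5 W1.
  + by rewrite [LHS]w5.
  move=> j bj; rewrite -[want_of _ j]/(want_of s5 j) -[Wof _ _ _]/(Wof s5 _ _).
  rewrite -[want_of _ j.*2]/(want_of s5 j.*2) -[want_of _ j.*2.+1]/(want_of s5 j.*2.+1).
  rewrite W5 !w5.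
  have -> : (j == i.*2.+1) = false by rewrite /i; lia.
  have -> : (j == i.*2) = false by rewrite /i; lia.
  have -> : (j.*2 == i.*2.+1) = false by lia.
  have -> : (j.*2 == i.*2) = (j == i) by lia.
  have -> : (j.*2.+1 == i.*2.+1) = (j == i) by lia.
  have -> : (j.*2.+1 == i.*2) = false by lia.
  have [->|ne] := eqVneq j i; first by [].
  by apply: tr1; move: ne; rewrite /i; lia.
- move=> s' bs' _ [cs' T' W' w' tr']; split=> // i bi.
  by apply: tr'; lia.
Qed.

Lemma output_ends s :
  bounded W s -> consts s ->
  ends W L output_cmd s (fun s' =>
    forall j, j < n -> cell s' j = n.+1 - Tof s (n + j) (want_of s (n + j))).
Proof.
move=> bs cs.
pose Inv k s' := [/\ consts s', forall a, Z <= a -> cell s' a = cell s a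
  & forall j, j < k -> cell s' j = n.+1 - Tof s (n + j) (want_of s (n + j))].
apply: (@ends_for _ _ _ _ _ _ n Inv) => //; [lia|lia|..].
- by move=> k s' [cs' _ _]; rewrite /= cs'.
- by split=> //; apply: consts_assigned.
- move=> k s1 lt_k bs1 xk [cs1 hi1 out1].
  have n1 : reg s1 rn = n by rewrite cs1.
  apply: (@ends_storeE _ _ k (n.+1 - Tof s (n + k) (want_of s (n + k)))) => //.
  + rewrite -[LHS]/(reg s1 rn + 1 - cell s1 (eval s1 (table (Const 1) (Add (Reg rn) (Reg rt))
      (Fetch (slot (Const 3) (Add (Reg rn) (Reg rt))))))).
    rewrite eval_table // -[eval s1 (Fetch _)]/(
      cell s1 (eval s1 (slot (Const 3) (Add (Reg rn) (Reg rt))))).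
    by rewrite eval_slot //= n1 xk addn1 !hi1 //; lia.
  + by apply: leq_trans (leq_subr _ _) _; lia.
  split=> //; split=> /=.
  + exact: consts_assigned.
  + by move=> a le_a; rewrite /update; case: eqP => [|_]; [lia | apply: hi1].
  + move=> j le_j; rewrite /update; case: eqP => [-> //|ne].
    by apply: out1; lia.
- by move=> s' _ _ [].
Qed.

Lemma main_ends s :
  bounded W s -> reg s rm = m -> cell s =1 inp ->
  ends W L (main_cmd c) s (fun s' =>
    (exists2 x : nat -> bool, \sum_(j < n) x j <= B
       & forall i, i < m -> r i <= \sum_(j < n) x j * S j i) ->
    \sum_(j < n) (cell s' j != 0) <= B /\
    forall i, i < m ->
      C * (r i - \sum_(j < n) (cell s' j != 0) * S j i) <= 2 * r i).
Proof.
move=> bs sm sc.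
apply: ends_seq (setup_ends bs sm sc) _ => s1 b1 [cs1 bas1 z1].
apply: ends_seq (leaves_ends b1 cs1 bas1 z1) _ => s2 b2 [cs2 bas2 lv2 z2].
apply: ends_seq (merge_ends b2 cs2 bas2 lv2 z2) _ => s3 b3 [cs3 bas3 [lv3 mg3]].
apply: ends_seq (pick_ends b3 cs3 bas3) _ => s4 b4 [ag4 lt4 ps4].
have cs4 : consts s4 by apply: consts_agree ag4 cs3.
apply: ends_seq (trace_ends b4 cs4) _ => s5 b5 [cs5 T5 W5 w5 tr5].
apply: ends_weaken (output_ends b5 cs5) => s6 b6 out6 [x cardX covX].
have T34 : Tof s4 = Tof s3 by rewrite /Tof ag4.1.
have W34 : Wof s4 = Wof s3 by rewrite /Wof ag4.1.
have pk := ps4 (dp_complete n0 (erefl _) c0 n_lt lv3 mg3 cardX covX).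
apply: (dp_sound n0 (erefl _) c0 n_lt lv3 mg3 (want := want_of s5) (out := cell s6)).
- by rewrite w5.
- by rewrite w5.
- by move=> i /tr5; rewrite W5 W34.
- by move=> j lt_j; rewrite out6 // T5 T34.
Qed.

End Run.

(** * Running time *)

Lemma leq_expl x y k : x <= y -> x ^ k <= y ^ k.
Proof. by case: k => // k; rewrite leq_exp2r. Qed.

(** For x near log n this trades (log n) ^ p for a function of p times n. It compares x ^ p with the
    falling factorial of x + p, that is, a binomial coefficient below 2 ^ (x + p) times p!. *)
Lemma pow_le_exp2 x p : x ^ p <= p ^ p * 2 ^ (x + p).
Proof.
have ffact_ge : x ^ p <= (x + p) ^_ p.
  elim: p => [|p IH]; first by rewrite ffactn0.
  by rewrite expnS addnS ffactSS leq_mul // leqW // leq_addr.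
have bin_le : 'C(x + p, p) <= 2 ^ (x + p).
  have lt_p : p < (x + p).+1 by rewrite ltnS leq_addl.
  by rewrite -[2]/(1 + 1) expnDn (bigD1 (Ordinal lt_p)) //= !exp1n !muln1 leq_addr.
have fact_le : p`! <= p ^ p.
  rewrite -ffactnn; have le k : p ^_ k <= p ^ k.
    elim: k => [|k IH]; first by rewrite ffactn0.
    by rewrite ffactnSr expnSr leq_mul // leq_subr.
  exact: le.
apply: leq_trans ffact_ge _; rewrite -bin_ffact mulnC; exact: leq_mul.
Qed.

Definition fpt_factor (A b e m : nat) : nat := A * (b * m) ^ (e * m).

Lemma fpt_factor_computable A b e : computable (fpt_factor A b e).
Proof.
exists (Assign 0 (Fetch (Const 0)) ;;
  Assign 1 (Const A) ;;
  For 2 (Mul (Const e) (Reg 0))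
    (Assign 1 (Mul (Reg 1) (Mul (Const b) (Reg 0)))) ;;
  Store (Const 0) (Reg 1)) => k.
(* The successor in the base keeps the powers monotone in the exponent even if b * k = 0. *)
pose W := A * (b * k).+1 ^ (e * k) + e * k + k.
have powW i : i <= e * k -> A * (b * k) ^ i <= W.
  move=> le_i; rewrite /W -addnA; apply: leq_trans (leq_addr _ _).
  rewrite leq_mul2l; apply/orP; right.
  by apply: leq_trans (leq_pexp2l _ le_i); first case: i le_i => // i _; rewrite ?leq_exp2r.
have bs : bounded W (init [:: k]).
  by split=> //= [[|a]] //=; rewrite ?nth_nil // /W leq_addl.
suff [s [t [ex _ _ eq_s]]] : ends W (e * k)
    (Assign 0 (Fetch (Const 0)) ;;
     Assign 1 (Const A) ;;
     For 2 (Mul (Const e) (Reg 0))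
       (Assign 1 (Mul (Reg 1) (Mul (Const b) (Reg 0)))) ;;
     Store (Const 0) (Reg 1)) (init [:: k]) (fun s => cell s 0 = fpt_factor A b e k).
  by exists s, t.
apply: (@ends_seq_assignE _ _ k) => //; first by rewrite /W leq_addl.
move=> b1; apply: (@ends_seq_assignE _ _ A) => //.
  by have := powW 0 isT; rewrite expn0 muln1.
move=> b2; pose Inv i s := reg s 0 = k /\ reg s 1 = A * (b * k) ^ i.
apply: (@ends_seq _ _ _ _ _ (Inv (e * k))).
  apply: (@ends_for _ _ _ _ _ _ (e * k) Inv) => //.
  - by rewrite /W -addnA addnCA leq_addr.
  - by move=> i s [k0 _]; rewrite /= k0.
  - by rewrite /Inv /= muln1.
  - move=> i s lt_i bs' xi [k0 p1].
    apply: (@ends_assignE _ _ (A * (b * k) ^ i.+1)) => //.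
      by rewrite /= k0 p1 -mulnA -expnSr.
    by apply: powW.
move=> s b3 [k0 p1]; apply: (@ends_storeE _ _ 0 (fpt_factor A b e k)) => //.
by apply: powW.
Qed.

(** * Arithmetic of the time bound *)

Section TimeArithmetic.

Variables (c m n l cst dp : nat).

Local Notation C := (2 ^ c).
Local Notation h := (bitlen n).
Local Notation K := (grid_size C c h).
Local Notation M := (num_keys m C c h).
Local Notation L := (3 + m + n * m + K + M * M).
Local Notation e := (4 * dp.+1).

Lemma grid_size_le : K <= (C * c.+1 + 1) * h.+1 ^ 2.
Proof.
rewrite /grid_size /grid_den -mulnn.
have le : h + c <= h.+1 * c.+1 by nia.
rewrite mulnDl mul1n; apply: leq_add => //.
have -> : C * c.+1 * (h.+1 * h.+1) = C * h.+1 * (h.+1 * c.+1) by nia.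
by rewrite leq_mul2l le orbT.
Qed.

(* As K = O(log^2 n), the power K ^ O(m) is at most a function of m times n. *)
Lemma fpt_time :
  0 < m -> 0 < n -> 3 + m + n * m <= l ->
  cst * (c + 3 + 2 * l + K + L) * L.+1 ^ dp <=
  fpt_factor (cst * (c + 9) * 4 ^ dp.+1) (2 * (C * c.+1 + 1) * e) e m *
    l ^ dp.+2.
Proof.
move=> m0 n0 le_l; set c2 := C * c.+1 + 1; pose Y := K ^ (2 * m).
have l0 : 0 < l by lia.
have K0 : 0 < K by apply: K_gt0.
have Y0 : 0 < Y by rewrite expn_gt0 K0.
have MY : M * M = Y by rewrite /num_keys -expnD addnn -mul2n.
have KY : K <= Y by rewrite -{1}[K]expn1 leq_pexp2l // muln_gt0.
have lY : l <= l * Y by rewrite leq_pmulr.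
have Yl : Y <= l * Y by rewrite leq_pmull.
have L1 : L.+1 <= 4 * (l * Y) by rewrite MY; lia.
have wE : c + 3 + 2 * l + K + L <= (c + 9) * (l * Y).
  rewrite MY; have : c <= c * (l * Y) by rewrite leq_pmulr // muln_gt0 l0.
  by rewrite mulnDl; lia.
(* The factor 4 (dp + 1) in e collects 2 for pairs of keys, 2 for K being quadratic in log n, and dp
   + 1 for the loops and the word length. *)
have [p pE] : exists p, p = e * m by exists (e * m).
have Yp : Y ^ dp.+1 <= 4 * l * (2 * c2 * p) ^ p.
  have -> : Y ^ dp.+1 = K ^ (2 * m * dp.+1) by rewrite -expnM.
  apply: leq_trans (_ : (c2 * h.+1 ^ 2) ^ (2 * m * dp.+1) <= _).
    by rewrite leq_exp2r ?grid_size_le // !muln_gt0 m0.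
  rewrite expnMn -expnM.
  have pE2 : 2 * (2 * m * dp.+1) = p by rewrite pE; ring.
  rewrite pE2.
  have c2p : c2 ^ (2 * m * dp.+1) <= c2 ^ p.
    by rewrite leq_pexp2l // /c2 ?addn1 // -pE2 leq_pmull.
  have hp := pow_le_exp2 h.+1 p.
  (* As m > 0, the input lists n m >= n multiplicities, so n is at most l. *)
  have h2 : 2 ^ h.+1 <= 4 * l.
    have le_h : 2 ^ h.-1 <= n by rewrite -bitlen_gtP.
    have -> : 2 ^ h.+1 = 4 * 2 ^ h.-1.
      by rewrite -[4]/(2 ^ 2) -expnD.
    by rewrite leq_mul2l /= (leq_trans le_h) // (leq_trans _ le_l) // (leq_trans _ (leq_addl _ _)) // leq_pmulr.
  apply: leq_trans (leq_mul c2p hp) _.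
  rewrite expnD !expnMn.
  have -> : 4 * l * (2 ^ p * c2 ^ p * p ^ p) = c2 ^ p * (p ^ p * (4 * l * 2 ^ p)) by ring.
  by do 2!apply: leq_mul => //; apply: leq_mul.
have -> : fpt_factor (cst * (c + 9) * 4 ^ dp.+1) (2 * c2 * e) e m =
    cst * (c + 9) * 4 ^ dp.+1 * (2 * c2 * p) ^ p.
  by rewrite /fpt_factor -pE -[2 * c2 * e * m]mulnA -pE.
apply: leq_trans (_ : cst * ((c + 9) * (l * Y)) * (4 * (l * Y)) ^ dp <= _).
  by apply: leq_mul; [rewrite leq_mul2l wE orbT | apply: leq_expl].
have -> : cst * ((c + 9) * (l * Y)) * (4 * (l * Y)) ^ dp =
    cst * (c + 9) * 4 ^ dp * l ^ dp.+1 * Y ^ dp.+1.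
  by rewrite !expnMn !expnS; ring.
have -> : cst * (c + 9) * 4 ^ dp.+1 * (2 * c2 * p) ^ p * l ^ dp.+2 =
    cst * (c + 9) * 4 ^ dp * l ^ dp.+1 * (4 * l * (2 * c2 * p) ^ p).
  by rewrite !expnS; ring.
by rewrite leq_mul2l Yp orbT.
Qed.

End TimeArithmetic.

Import Order.TTheory GRing.Theory Num.Theory.

(** * The encoding *)

Lemma nth_allpairs (T1 T2 T : Type) (f : T1 -> T2 -> T) x1 x2 x s t i j :
  i < size t -> j < size s ->
  nth x [seq f a b | a <- s, b <- t] (j * size t + i) = f (nth x1 s j) (nth x2 t i).
Proof.
move=> lt_i; elim: s j => [//|a s IH] [|j] lt_j /=.
  by rewrite nth_cat size_map lt_i (nth_map x2).
rewrite nth_cat size_map mulSn -addnA ltnNge leq_addr /= addKn.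
exact: IH.
Qed.

Lemma size_encode I : size (encode I) = 3 + univ_size I + num_sets I * univ_size I.
Proof. by rewrite /= size_cat size_map size_allpairs !size_enum_ord !addSn add0n. Qed.

Lemma nth_encode_requirement I (i : 'I_(univ_size I)) :
  nth 0 (encode I) (3 + i) = requirement i.
Proof.
have lt_i : i < size (enum 'I_(univ_size I)) by rewrite size_enum_ord.
by rewrite /= nth_cat size_map lt_i (nth_map i) // nth_ord_enum.
Qed.

Lemma nth_encode_mset I (j : 'I_(num_sets I)) (i : 'I_(univ_size I)) :
  nth 0 (encode I) (3 + univ_size I + j * univ_size I + i) = mset_of j i.
Proof.
rewrite -addnA -addnA [nth _ _ _]/= nth_cat size_map size_enum_ord.
rewrite ltnNge leq_addr /= add0n addKn.
have -> : j * univ_size I + i = j * size (enum 'I_(univ_size I)) + i.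
  by rewrite size_enum_ord.
by rewrite (nth_allpairs _ j i) ?size_enum_ord // !nth_ord_enum.
Qed.

Lemma nth_encode_lt I a : nth 0 (encode I) a < 2 ^ input_size I.
Proof.
have [lt_a|ge_a] := ltnP a (size (encode I)); last first.
  by rewrite nth_default // expn_gt0.
apply: leq_trans (bitlen_gt _) _; rewrite leq_exp2l //.
by rewrite /input_size (big_nth 0) big_mkord (bigD1 (Ordinal lt_a)) //= leq_addr.
Qed.

Lemma size_encode_le I : size (encode I) <= input_size I.
Proof. by rewrite /input_size -sum1_size leq_sum. Qed.

Lemma almost_cover_of_relative (eps : rat) c I (X : {set 'I_(num_sets I)}) :
  (2%:R / eps < (2 ^ c)%:R)%R -> (0 < eps)%R -> #|X| <= budget I ->
  (forall i, 2 ^ c * (requirement i - coverage X i) <= 2 * requirement i) ->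
  almost_cover eps X.
Proof.
move=> lt_c eps0 cardX covX; split=> // tot0.
have le_tot : 2 ^ c * shortfall X <= 2 * total_requirement I.
  by rewrite /shortfall /total_requirement !big_distrr leq_sum.
have C0 : (0 < (2 ^ c)%:R :> rat)%R by rewrite ltr0n expn_gt0.
rewrite -(ltr_pM2l C0) -natrM.
apply: le_lt_trans (_ : ((2 * total_requirement I)%:R < _)%R).
  by rewrite ler_nat.
rewrite natrM mulrA ltr_pM2r ?ltr0n //.
by rewrite -ltr_pdivrMr.
Qed.

(** * Correctness and time on encoded instances *)

Section Correctness.

Variables (c : nat) (I : instance).
Hypothesis c0 : 0 < c.

Local Notation m := (univ_size I).
Local Notation n := (num_sets I).
Local Notation inp := (nth 0 (encode I)).

Definition good_output (s : state) : Prop :=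
  (exists X : {set 'I_n}, solution X) ->
  #|output I s| <= budget I /\
  forall i, 2 ^ c * (requirement i - coverage (output I s) i) <= 2 * requirement i.

(** No loop is entered, hence the iteration bound 0 and a time linear in the word length. *)
Lemma trivial_ends W :
  (forall a, inp a <= W) -> (m == 0) || (n == 0) ->
  ends W 0 (multicover_cmd c) (init (encode I)) good_output.
Proof.
move=> leW triv.
have bs : bounded W (init (encode I)) by split.
apply: (@ends_seq_assignE _ _ m) => //; first exact: (leW 0).
set s1 := assigned _ _ _ => b1.
apply: ends_if => //= mE.
  have nE : n = 0 by move: triv mE; rewrite /update /=; lia.
  apply: ends_if => //=; first by rewrite nE.
  move=> _; apply: ends_skip => // -[X [cardX covX]].
  (* Without sets nothing is covered, so an exact solution forces all requirements to be 0. *)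
  have cov0 (Y : {set 'I_n}) i : coverage Y i = 0.
    by rewrite /coverage big1 // => j; have := ltn_ord j; rewrite {2}nE.
  split=> [|i].
    apply: leq_trans (max_card _) _; rewrite card_ord; lia.
  by have := covX i; rewrite cov0 leqn0 => /eqP ->; rewrite sub0n muln0.
apply: (@ends_seq_storeE _ _ 1 0) => // b2; apply: (@ends_storeE _ _ 2 0) => //.
have m0 : m = 0 by move: mE; rewrite /update /=.
have out0 : output I (stored (stored s1 1 0) 2 0) = set0.
  apply/setP => j; rewrite !inE -[cell _ _]/(update (update inp 1 0) 2 0 j).
  rewrite /update; case: ifP => // /eqP ne2; case: ifP => // /eqP ne1.
  have [->|ne0] := eqVneq (j : nat) 0; first by rewrite -[nth _ _ _]/m m0.
  by rewrite nth_default // size_encode m0; move/eqP: ne0; lia.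
move=> _; rewrite out0; split=> [|i]; first by rewrite cards0.
by have := ltn_ord i; rewrite {2}m0.
Qed.

Lemma main_good W L :
  0 < m -> 0 < n ->
  (forall a, inp a <= W) ->
  3 + m + n * m + grid_size (2 ^ c) c (bitlen n) +
    num_keys m (2 ^ c) c (bitlen n) * num_keys m (2 ^ c) c (bitlen n) <= L ->
  L <= W ->
  (forall a, (2 * scale n (2 ^ c) * inp a + 1) *
     2 ^ grid_size (2 ^ c) c (bitlen n) <= W) ->
  ends W L (multicover_cmd c) (init (encode I)) good_output.
Proof.
move=> m0 n0 leW geL L_W geW.
have bs : bounded W (init (encode I)) by split.
apply: (@ends_seq_assignE _ _ m) => //; first exact: (leW 0).
set s1 := assigned _ _ _ => b1.
apply: ends_if => //= mE; last by move: mE; rewrite /update /=; lia.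
apply: ends_if => //= nE; last by lia.
apply: ends_weaken (@main_ends W L m n (budget I) c inp n0 m0 c0 _ _ _ geL L_W geW s1 b1 _ _) => //.
  move=> s bs' H [X [cardX covX]].
  pose x (j : nat) := oapp (fun j' : 'I_n => j' \in X) false (insub j).
  have xE (j : 'I_n) : x j = (j \in X) by rewrite /x valK.
  have [|cardO covO] := H.
    exists x.
      rewrite (eq_bigr (fun j : 'I_n => (j \in X) : nat)); last by move=> j _; rewrite xE.
      by rewrite -big_mkcond sum1_card.
    move=> i lt_i; rewrite -[i]/(nat_of_ord (Ordinal lt_i)) nth_encode_requirement.
    apply: leq_trans (covX _) _; rewrite /coverage big_mkcond.
    apply: leq_sum => j _; rewrite xE nth_encode_mset.
    by case: (j \in X); rewrite ?mul1n.
  have cE : #|output I s| = \sum_(j < n) (cell s j != 0).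
    by rewrite -sum1_card big_mkcond; apply: eq_bigr => j _; rewrite inE; case: eqP.
  split=> [|i]; first by rewrite cE.
  have := covO i (ltn_ord i); rewrite (nth_encode_requirement i).
  have -> // : \sum_(j < n) (cell s j != 0) * inp (3 + m + j * m + i) =
    coverage (output I s) i.
  rewrite /coverage [RHS]big_mkcond; apply: eq_bigr => j _.
  by rewrite inE nth_encode_mset; case: eqP; rewrite ?mul1n.
by move=> a le_a; rewrite nth_default // size_encode.
Qed.

Lemma multicover_run :
  let dp := loop_depth (multicover_cmd c) in
  let cst := cmd_cost (multicover_cmd c) in
  exists s t, [/\ exec (multicover_cmd c) (init (encode I)) s t, good_output s
    & t <= fpt_factor (cst * (c + 9) * 4 ^ dp.+1)
             (2 * (2 ^ c * c.+1 + 1) * (4 * dp.+1)) (4 * dp.+1) m *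
           input_size I ^ dp.+2].
Proof.
move=> dp cst; set l := input_size I.
have le_l : 3 + m + n * m <= l by rewrite -size_encode size_encode_le.
have l0 : 0 < l by lia.
have bitE k : bitlen (2 ^ k) = k.+1 by rewrite /bitlen trunc_expnK.
have inp_lt a : inp a < 2 ^ l by apply: nth_encode_lt.
have [triv|] := boolP ((m == 0) || (n == 0)).
  have [|s [t [ex le_t _ gs]]] := @trivial_ends (2 ^ l) _ triv.
    by move=> a; apply: ltnW.
  exists s, t; split=> //; apply: leq_trans le_t _; rewrite bitE.
  apply: leq_trans (time_bound_le _ _ _) _; rewrite exp1n muln1 -/cst.
  rewrite /fpt_factor; set F := _ ^ (_ * m).
  (* For m = 0 the base vanishes, but so does the exponent, and the factor is 1. *)
  have F0 : 0 < F.
    by rewrite expn_gt0 !muln_gt0 !addn1 /=; case: (m).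
  have l2 : l.+1 <= 4 * l ^ dp.+2.
    rewrite expnS; have : 0 < l ^ dp.+1 by rewrite expn_gt0 l0.
    nia.
  have P0 : 0 < 4 ^ dp by rewrite expn_gt0.
  have -> : cst * (c + 9) * 4 ^ dp.+1 * F * l ^ dp.+2 =
      cst * ((c + 9) * 4 ^ dp * F * (4 * l ^ dp.+2)) by rewrite !expnS; ring.
  rewrite leq_mul2l; apply/orP; right; apply: leq_trans l2 _.
  apply: leq_pmull; rewrite muln_gt0 F0 andbT muln_gt0 P0 andbT; lia.
rewrite negb_or -!lt0n => /andP[m0 n0].
pose K := grid_size (2 ^ c) c (bitlen n).
pose M := num_keys m (2 ^ c) c (bitlen n).
pose L := 3 + m + n * m + K + M * M.
(* W = 2 ^ E has a bit length linear in l, K and L. The part c + 2 + 2 l is for 2 N v + 1 with n and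
   the input number v below 2 ^ l, K is for the grid, and L ensures L <= W. *)
pose E := c + 2 + 2 * l + K + L.
have le_pow k : k <= E -> 2 ^ k <= 2 ^ E by move=> le; rewrite leq_exp2l.
have [||||s [t [ex le_t _ gs]]] := @main_good (2 ^ E) L m0 n0.
- by move=> a; apply: leq_trans (ltnW (inp_lt a)) (le_pow _ _); rewrite /E; lia.
- exact: leqnn.
- by apply: leq_trans (ltnW (ltn_expl L (isT : 1 < 2))) (le_pow _ _); rewrite /E; lia.
- move=> a; rewrite -/K; apply: leq_trans (_ : 2 ^ (c + 2 + 2 * l) * 2 ^ K <= _); last first.
    by rewrite -expnD; apply: le_pow; rewrite /E; lia.
  rewrite leq_mul2r; apply/orP; right.
  have := inp_lt a; have : n < 2 ^ l := inp_lt 1.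
  have -> : 2 ^ (c + 2 + 2 * l) = 2 ^ c * 2 ^ 2 * (2 ^ l * 2 ^ l).
    by rewrite [2 * l]mul2n -addnn !expnD.
  rewrite /scale.
  have := expn_gt0 2 c; move: (inp a) (2 ^ l) (2 ^ c) => v X Y /= Y0 lt_n lt_v.
  have le : n * v + 1 <= X * X by nia.
  have -> : 2 * (n * Y) * v = 2 * Y * (n * v) by ring.
  have -> : Y * 2 ^ 2 * (X * X) = 2 * Y * (X * X) + 2 * Y * (X * X) by ring.
  by nia.
exists s, t; split=> //; apply: leq_trans le_t _; rewrite bitE.
apply: leq_trans (time_bound_le _ _ _) _; rewrite -/cst -/dp.
have -> : E.+1 = c + 3 + 2 * l + K + L by rewrite /E; lia.
exact: fpt_time.
Qed.

End Correctness.

Theorem theorem5 (eps : rat) (eps_gt0 : (0 < eps)%R) :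
  exists (c : cmd) (f : nat -> nat) (d : nat),
    [/\ computable f,
        almost_cover_algorithm eps c
      & runs_in_time c (fun I : instance => f (univ_size I) * input_size I ^ d)].
Proof.
(* The successor makes c positive, so that C = 2 ^ c is at least 2. *)
pose c := (Num.Def.archi_bound (2%:R / eps)%R).+1.
have lt_c : (2%:R / eps < (2 ^ c)%:R)%R.
  by rewrite natrX; apply: upper_nthrootP; rewrite /c.
pose dp := loop_depth (multicover_cmd c).
pose cst := cmd_cost (multicover_cmd c).
exists (multicover_cmd c).
exists (fpt_factor (cst * (c + 9) * 4 ^ dp.+1)
          (2 * (2 ^ c * c.+1 + 1) * (4 * dp.+1)) (4 * dp.+1)), dp.+2.
split; first exact: fpt_factor_computable.
- move=> I sol; have [s [t [ex good _]]] := multicover_run I (isT : 0 < c).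
  exists s, t; split=> //; have [cardX covX] := good sol.
  exact: almost_cover_of_relative covX.
- move=> I; have [s [t [ex _ le_t]]] := multicover_run I (isT : 0 < c).
  by exists s, t.
Qed.
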